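(* Let $H$ and $K$ be locally compact groups, let $\tau:H\to Aut(K)$ be a continuous homomorphism and let $G_\tau=H\ltimes_\tau K$. Then the left $\tau$-convolution $\stackrel{\tau_l}{\ast}$ makes $L^1(G_\tau)$ into a Banach algebra (i.e. it is a bilinear, associative product on $L^1(G_\tau)$ with $\|f\stackrel{\tau_l}{\ast}g\|_{L^1(G_\tau)}\le\|f\|_{L^1(G_\tau)}\|g\|_{L^1(G_\tau)}$).
   Context: $H,K$ have left Haar measures $dh$ (also written $dt$) and $dk$ (also $ds$). A homomorphism $\tau:H\to Aut(K)$, $h\mapsto\tau_h$, is called continuous if $(h,k)\mapsto\tau_h(k)$ is continuous from $H\times K$ to $K$. The semidirect product $G_\tau=H\ltimes_\tau K$ is the set $H\times K$ with the product topology and the operation $(h,k)\ltimes_\tau(h',k')=(hh',k\tau_h(k'))$. The continuous homomorphism $\delta:H\to(0,\infty)$ is given by $dk=\delta(h)\,d(\tau_h(k))$, i.e. $|E|=\delta(h)|\tau_h(E)|$ for Haar measure $|\cdot|$ on $K$; a left Haar measure of $G_\tau$ is $\delta(h)\,dh\,dk$, and $L^1(G_\tau)$ is taken with respect to it. For $f\in L^1(G_\tau)$ and $t\in H$ put $f_t(k)=f(t,k)$ (so $f_t\in L^1(K)$ for a.e. $t$). With $\ast$ the standard convolution on $L^1(K)$, the left $\tau$-convolution of $f,g\in L^1(G_\tau)$ is $$f\stackrel{\tau_l}{\ast}g(h,k)=\int_H f_t\ast g_h(k)\,\delta(t)\,dt .$$ *)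

(* Defs.v *)
From HB Require Import structures.
From mathcomp Require Import all_boot all_order all_algebra.
From mathcomp Require Import all_classical all_reals all_analysis.
From mathcomp Require Import measurable_realfun complex ring_quotient.

Set Implicit Arguments.
Unset Strict Implicit.
Unset Printing Implicit Defensive.

Import Order.TTheory GRing.Theory Num.Theory.
Import numFieldNormedType.Exports Normc.

Local Open Scope classical_set_scope.
Local Open Scope ring_scope.
Local Open Scope complex_scope.

HB.mixin Record isTopGroup G & Group G & Topological G := {
  mulg_continuous : continuous (fun x : G * G => (x.1 * x.2)%g) ;
  invg_continuous : continuous (fun x : G => (x^-1)%g)
}.

#[short(type="topGroupType")]
HB.structure Definition TopGroup :=
  {G of Group G & PointedTopological G & isTopGroup G}.

Definition lc_hausdorff (G : topGroupType) : Prop :=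
  locally_compact [set: G] /\ hausdorff_space G.

Notation borel T := (g_sigma_algebraType (@open T)).

Section Radon.
Context (R : realType) (T : ptopologicalType).
Implicit Type mu : {measure set (borel T) -> \bar R}.

(* Outer regularity is required of all Borel sets but inner regularity of open
   sets only: on a group that is not sigma-compact, Haar measure need not be
   inner regular on all Borel sets. *)
Definition radon mu : Prop :=
  [/\ forall C : set T, compact C -> (mu C < +oo)%E,
      forall E : set (borel T), measurable E ->
        mu E = ereal_inf [set mu U | U in [set U : set T | open U /\ E `<=` U]]
    & forall U : set T, open U ->
        mu U = ereal_sup [set mu C | C in [set C : set T | compact C /\ C `<=` U]]].
End Radon.

Definition left_haar (R : realType) (G : topGroupType)
    (mu : {measure set (borel G) -> \bar R}) : Prop :=
  [/\ radon mu, mu [set: G] != 0%E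
    & forall (g : G) (E : set (borel G)), measurable E ->
        mu ((fun x : G => (g * x)%g) @` E) = mu E].

Definition topgroup_automorphism (K : topGroupType) (a : K -> K) : Prop :=
  {morph a : x y / (x * y)%g} /\
  exists b : K -> K, [/\ cancel a b, cancel b a, continuous a & continuous b].

Record autHom (H K : topGroupType) := AutHom {
  aut_of :> H -> K -> K ;
  aut_ofP : forall h, topgroup_automorphism (aut_of h) ;
  aut_ofM : forall h h', aut_of (h * h')%g = aut_of h \o aut_of h' ;
  aut_of_continuous : continuous (fun x : H * K => aut_of x.1 x.2)
}.

Definition semidirect (H K : topGroupType) (tau : autHom H K) : Type :=
  (H * K)%type.

Section Semidirect.
Context (H K : topGroupType) (tau : autHom H K).
Let G := semidirect tau.

HB.instance Definition _ := Topological.copy (semidirect tau) (H * K)%type.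
HB.instance Definition _ := Pointed.copy (semidirect tau) (H * K)%type.

Definition sdmul (x y : G) : G := ((x.1 * y.1)%g, (x.2 * tau x.1 y.2)%g).
Definition sdone : G := (1%g, 1%g).
Definition sdinv (x : G) : G := ((x.1^-1)%g, tau (x.1^-1)%g (x.2^-1)%g).

Let tauM h : {morph tau h : x y / (x * y)%g}.
Proof. by have [] := aut_ofP tau h. Qed.

Let tau1 h : tau h 1%g = 1%g.
Proof. by apply: (@mulgI _ (tau h 1%g)); rewrite -tauM !mulg1. Qed.

Let tau1g x : tau 1%g x = x.
Proof.
have [_ [b [ab _ _ _]]] := aut_ofP tau 1%g.
by apply: (can_inj ab); rewrite -[LHS]/((tau 1%g \o tau 1%g) x) -aut_ofM mulg1.
Qed.

Let sdmulA : associative sdmul.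
Proof.
move=> x y z; rewrite /sdmul /=. congr pair; first exact: mulgA.
by rewrite tauM aut_ofM mulgA.
Qed.

Let sdmul1 : left_id sdone sdmul.
Proof. by case=> h k; rewrite /sdmul /= !mul1g tau1g. Qed.

Let sdmulr1 : right_id sdone sdmul.
Proof. by case=> h k; rewrite /sdmul /= !mulg1 tau1 mulg1. Qed.

Let sdmulV : left_inverse sdone sdinv sdmul.
Proof. by case=> h k; rewrite /sdmul /sdinv /= mulVg -tauM mulVg tau1. Qed.

Let sdmulrV : right_inverse sdone sdinv sdmul.
Proof.
case=> h k; rewrite /sdmul /sdinv /= mulgV.
by rewrite -[tau h _]/((tau h \o tau _) _) -aut_ofM mulgV tau1g mulgV.
Qed.

HB.instance Definition _ := isGroup.Build (semidirect tau)
  sdmulA sdmul1 sdmulr1 sdmulV sdmulrV.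

Let cvg_mul (L : topGroupType) (T : topologicalType) (u v : T -> L) :
  continuous u -> continuous v -> continuous (fun x => (u x * v x)%g).
Proof.
move=> cu cv x; apply: (@continuous_comp _ _ _ (fun x => (u x, v x))
  (fun y : L * L => (y.1 * y.2)%g)); last exact: mulg_continuous.
by apply: cvg_pair; [exact: cu|exact: cv].
Qed.

Let cvg_inv (L : topGroupType) (T : topologicalType) (u : T -> L) :
  continuous u -> continuous (fun x => ((u x)^-1)%g).
Proof.
by move=> cu x; apply: continuous_comp; [exact: cu|exact: invg_continuous].
Qed.

Let cvg_aut (T : topologicalType) (u : T -> H) (v : T -> K) :
  continuous u -> continuous v -> continuous (fun x => tau (u x) (v x)).
Proof.
move=> cu cv x; apply: (@continuous_comp _ _ _ (fun x => (u x, v x))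
  (fun y : H * K => tau y.1 y.2)); last exact: aut_of_continuous.
by apply: cvg_pair; [exact: cu|exact: cv].
Qed.

Let cont_fst (X Y : topologicalType) : continuous (@fst X Y).
Proof. by move=> x; exact: cvg_fst. Qed.

Let cont_snd (X Y : topologicalType) : continuous (@snd X Y).
Proof. by move=> x; exact: cvg_snd. Qed.

Let cont_comp (X Y Z : topologicalType) (u : X -> Y) (v : Y -> Z) :
  continuous u -> continuous v -> continuous (fun x => v (u x)).
Proof. by move=> cu cv x; apply: continuous_comp; [exact: cu|exact: cv]. Qed.

Let cont_pair (T : topologicalType) (u : T -> H) (v : T -> K) :
  continuous u -> continuous v -> continuous (fun x => (u x, v x)).
Proof. by move=> cu cv x; apply: cvg_pair; [exact: cu|exact: cv]. Qed.

Let sdmul_continuous : continuous (fun x : G * G => (x.1 * x.2)%g).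
Proof.
have c1 : continuous (fun x : G * G => x.1 : H * K) by exact: cont_fst.
have c2 : continuous (fun x : G * G => x.2 : H * K) by exact: cont_snd.
apply: (@cont_pair (G * G)%type (fun x => (x.1.1 * x.2.1)%g)
  (fun x => (x.1.2 * tau x.1.1 x.2.2)%g)).
- apply: (@cvg_mul H (G * G)%type (fun x => x.1.1) (fun x => x.2.1)) => //.
  + exact: cont_comp c1 (@cont_fst _ _).
  + exact: cont_comp c2 (@cont_fst _ _).
- apply: (@cvg_mul K (G * G)%type (fun x => x.1.2)
    (fun x => tau x.1.1 x.2.2)).
  + exact: cont_comp c1 (@cont_snd _ _).
  + apply: (@cvg_aut (G * G)%type (fun x => x.1.1) (fun x => x.2.2)).
    * exact: cont_comp c1 (@cont_fst _ _).
    * exact: cont_comp c2 (@cont_snd _ _).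
Qed.

Let sdinv_continuous : continuous (fun x : G => (x^-1)%g).
Proof.
have c1 : continuous (fun x : G => x.1 : H) by exact: cont_fst.
have c2 : continuous (fun x : G => x.2 : K) by exact: cont_snd.
apply: (@cont_pair G (fun x => (x.1^-1)%g)
  (fun x => tau (x.1^-1)%g (x.2^-1)%g)).
- exact: (@cvg_inv H G (fun x => x.1) c1).
- exact: (@cvg_aut G (fun x => (x.1^-1)%g) (fun x => (x.2^-1)%g)
    (cvg_inv c1) (cvg_inv c2)).
Qed.

HB.instance Definition _ := isTopGroup.Build (semidirect tau)
  sdmul_continuous sdinv_continuous.
End Semidirect.


Section L1.
Context d (T : measurableType d) (R : realType).
Variable mu : {measure set T -> \bar R}.

Definition cintegrable (f : T -> R[i]) : Prop :=
  mu.-integrable setT (fun x => (complex.Re (f x))%:E) /\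
  mu.-integrable setT (fun x => (complex.Im (f x))%:E).

Definition cintegral (f : T -> R[i]) : R[i] :=
  (\int[mu]_x complex.Re (f x)) +i* (\int[mu]_x complex.Im (f x)).

Definition L1pred : {pred (T -> R[i])} := fun f => `[< cintegrable f >].

Lemma L1pred_submod_closed : submod_closed L1pred.
Proof.
split.
  by apply/asboolP; split; exact: integrable0.
move=> a f g /asboolP[fr fi] /asboolP[gr gi]; apply/asboolP; split.
- have : mu.-integrable setT ((fun x => (complex.Re a)%:E * (complex.Re (f x))%:E) \-
      (fun x => (complex.Im a)%:E * (complex.Im (f x))%:E) \+ (fun x => (complex.Re (g x))%:E))%E.
    apply: integrableD => //; apply: integrableB => //; exact: integrableZl.
  apply: eq_integrable => // x _.
  rewrite -[(a *: f + g) x]/(a * f x + g x).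
  by case: a (f x) (g x) => ? ? [? ?] [? ?].
- have : mu.-integrable setT ((fun x => (complex.Re a)%:E * (complex.Im (f x))%:E) \+
      (fun x => (complex.Im a)%:E * (complex.Re (f x))%:E) \+ (fun x => (complex.Im (g x))%:E))%E.
    apply: integrableD => //; apply: integrableD => //; exact: integrableZl.
  apply: eq_integrable => // x _.
  rewrite -[(a *: f + g) x]/(a * f x + g x).
  by case: a (f x) (g x) => ? ? [? ?] [? ?].
Qed.

HB.instance Definition _ :=
  GRing.isSubmodClosed.Build _ _ L1pred L1pred_submod_closed.

Record L1fun := MkL1fun {
  L1fun_val :> T -> R[i] ;
  L1fun_valP : L1fun_val \in L1pred
}.

HB.instance Definition _ := [isSub for L1fun_val].
HB.instance Definition _ := [Choice of L1fun by <:].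
HB.instance Definition _ := [SubChoice_isSubLmodule of L1fun by <:].

Definition L1null : {pred L1fun} := fun f => `[< {ae mu, forall x, f x = 0} >].

Lemma L1null_submod_closed : submod_closed L1null.
Proof.
split; first by apply/asboolP; exact: nearW.
move=> a f g /asboolP f0 /asboolP g0; apply/asboolP.
apply: filterS2 f0 g0 => x fx gx.
by rewrite -[(a *: f + g) x]/(a * f x + g x) fx gx mulr0 addr0.
Qed.

HB.instance Definition _ :=
  GRing.isSubmodClosed.Build _ _ L1null L1null_submod_closed.

Definition L1 : Type := Quotient.quot L1null.

HB.instance Definition _ := GRing.Zmodule.on L1.
HB.instance Definition _ := ZmodQuotient.on L1.

Local Open Scope quotient_scope.

Definition L1scale (a : R[i]) (x : L1) : L1 := \pi_L1 (a *: repr x).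

Lemma L1piP (f g : L1fun) :
  \pi_L1 f = \pi_L1 g <-> {ae mu, forall x, f x = g x}.
Proof.
split=> [/eqP|fg].
  rewrite -Quotient.idealrBE => /asboolP; apply: filterS => x.
  by move/eqP; rewrite -[(f - g) x]/(f x - g x) subr_eq0 => /eqP.
apply/eqP; rewrite -Quotient.idealrBE; apply/asboolP; apply: filterS fg => x.
by rewrite -[(f - g) x]/(f x - g x) => ->; rewrite subrr.
Qed.

Lemma L1scaleE a (f : L1fun) : L1scale a (\pi_L1 f) = \pi_L1 (a *: f).
Proof.
apply/L1piP; have /L1piP : \pi_L1 (repr (\pi_L1 f)) = \pi_L1 f by rewrite reprK.
apply: filterS => x fx.
by rewrite -[LHS]/(a * repr (\pi_L1 f) x) fx.
Qed.

Let L1D (f g : L1fun) : \pi_L1 (f + g) = \pi_L1 f + \pi_L1 g.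
Proof. exact: raddfD. Qed.

Let scaleA a b (x : L1) : L1scale a (L1scale b x) = L1scale (a * b) x.
Proof. by elim/quotW: x => f; rewrite (L1scaleE b) !L1scaleE scalerA. Qed.

Let scale1 : left_id 1 L1scale.
Proof. by elim/quotW => f; rewrite L1scaleE scale1r. Qed.

Let scaleDr : right_distributive L1scale +%R.
Proof.
move=> a; elim/quotW => f; elim/quotW => g.
by rewrite -L1D !L1scaleE scalerDr L1D.
Qed.

Let scaleDl (x : L1) : {morph L1scale^~ x : a b / a + b}.
Proof. by move=> a b; elim/quotW: x => f; rewrite !L1scaleE scalerDl L1D. Qed.

HB.instance Definition _ :=
  GRing.Zmodule_isLmodule.Build R[i] L1 scaleA scale1 scaleDr scaleDl.

Definition L1norm (x : L1) : R[i] := (\int[mu]_t normc (repr x t))%:C.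

Lemma L1fun_integrable (f : L1fun) : cintegrable f.
Proof. exact/asboolP/(L1fun_valP f). Qed.

Lemma normc_le_ReIm (z : R[i]) : normc z <= `|complex.Re z| + `|complex.Im z|.
Proof.
case: z => a b /=; rewrite -(ler_pXn2r (_ : 0 < 2)%N)// ?nnegrE ?addr_ge0//.
rewrite sqr_sqrtr ?addr_ge0 ?sqr_ge0// sqrrD !real_normK ?num_real//.
by rewrite addrAC lerDl mulrn_wge0// mulr_ge0.
Qed.

Lemma measurable_normc (f : L1fun) :
  measurable_fun setT (fun x => normc (f x)).
Proof.
have [/measurable_int/measurable_EFinP fr /measurable_int/measurable_EFinP fi] :=
  L1fun_integrable f.
have -> : (fun x => normc (f x)) =
    Num.sqrt \o (fun x => (complex.Re (f x)) ^+ 2 + (complex.Im (f x)) ^+ 2).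
  by apply/funext => x /=; case: (f x).
apply: measurableT_comp.
  by apply: continuous_measurable_fun; exact: sqrt_continuous.
by apply: measurable_funD; exact: measurable_funX.
Qed.

Lemma integrable_normc (f : L1fun) :
  mu.-integrable setT (fun x => (normc (f x))%:E).
Proof.
have [fr fi] := L1fun_integrable f.
have : mu.-integrable setT
  ((fun x => `|(complex.Re (f x))%:E|) \+ (fun x => `|(complex.Im (f x))%:E|))%E.
  by apply: integrableD => //; exact: integrable_abse.
apply: le_integrable => //.
  by apply/measurable_EFinP; exact: measurable_normc.
move=> x _; rewrite /= lee_fin ger0_norm ?sqrtr_ge0//.
  by rewrite ger0_norm ?addr_ge0// normc_le_ReIm.
by case: (f x) => a b; rewrite sqrtr_ge0.
Qed.

Lemma normc_ge0 (z : R[i]) : 0 <= normc z.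
Proof. by case: z => a b; rewrite sqrtr_ge0. Qed.

Lemma L1normE (f : L1fun) : L1norm (\pi_L1 f) = (\int[mu]_t normc (f t))%:C.
Proof.
rewrite /L1norm /Rintegral; congr (_%:C); congr fine.
apply: ae_eq_integral => //.
- by apply/measurable_EFinP; exact: measurable_normc.
- by apply/measurable_EFinP; exact: measurable_normc.
have /L1piP : \pi_L1 (repr (\pi_L1 f)) = \pi_L1 f by rewrite reprK.
by apply: filterS => x fx _; rewrite /= fx.
Qed.

Let L1norm_ler (x y : L1) : L1norm (x + y) <= L1norm x + L1norm y.
Proof.
elim/quotW: x => x; elim/quotW: y => y.
rewrite -L1D !L1normE -rmorphD lecR.
rewrite -RintegralD//; [|exact: integrable_normc..].
apply: le_Rintegral => //; [exact: integrable_normc| |].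
  have := integrableD measurableT (integrable_normc x)
    (integrable_normc y).
  by apply: eq_integrable => // t _.
by move=> t _; exact: le_normcD.
Qed.

Let L1normZ (a : R[i]) (x : L1) : L1norm (a *: x) = `|a| * L1norm x.
Proof.
elim/quotW: x => f; rewrite -[a *: _]/(L1scale _ _) L1scaleE !L1normE.
rewrite (_ : `|a| = (normc a)%:C)//.
rewrite -rmorphM -RintegralZl//; last exact: integrable_normc.
congr (_%:C); apply: eq_Rintegral => t _.
by rewrite -[(a *: f : L1fun) t]/(a * f t) normcM.
Qed.

Let L1norm_eq0 (x : L1) : L1norm x = 0 -> x = 0.
Proof.
elim/quotW: x => f; rewrite L1normE => /complexI f0.
rewrite -[RHS](raddf0 (\pi_L1)); apply/L1piP.
have : (\int[mu]_t `|(normc (f t))%:E| = 0)%E.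
  under eq_integral do rewrite gee0_abs ?lee_fin ?normc_ge0//.
  rewrite -[LHS]fineK; last exact/integrable_fin_num/integrable_normc.
  by rewrite -/(Rintegral _ _ _) f0.
have mf : measurable_fun setT (fun t => (normc (f t))%:E).
  by apply/measurable_EFinP; exact: measurable_normc.
move/(ae_eq_integral_abs mu measurableT mf); apply: filterS => t /(_ I).
by case=> /eq0_normc.
Qed.

HB.instance Definition _ :=
  Lmodule_isNormed.Build R[i] L1 L1norm_ler L1normZ L1norm_eq0.

End L1.

Definition L1class d (T : measurableType d) (R : realType)
    (mu : {measure set T -> \bar R}) (f : L1fun mu) : L1 mu :=
  (\pi_(L1 mu) f)%qT.

Definition L1repr d (T : measurableType d) (R : realType)
    (mu : {measure set T -> \bar R}) (u : L1 mu) : L1fun mu := repr u.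

Section TauConvolution.
Context (R : realType) (H K : topGroupType) (tau : autHom H K).
Variable muH : {measure set (borel H) -> \bar R}.
Variable muK : {measure set (borel K) -> \bar R}.
Variable delta : H -> R.
Implicit Type mu : {measure set (borel (semidirect tau)) -> \bar R}.

Definition tau_modulus : Prop :=
  [/\ continuous delta,
      forall h, 0 < delta h,
      forall h h', delta (h * h')%g = delta h * delta h'
    & forall h (E : set (borel K)), measurable E ->
        muK E = ((delta h)%:E * muK (tau h @` E))%E].

(* The measure delta(h) dh dk.  The iterated integral is imposed on open sets
   only: by outer regularity this determines mu, and when dh or dk is not
   sigma-finite the formula may fail for general Borel sets. *)
Definition is_semidirect_haar mu : Prop :=
  left_haar mu /\
  forall U : set (semidirect tau), open U ->
    mu U = (\int[muH]_h (muK [set k | U (h, k)] * (delta h)%:E))%E.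

Definition group_conv (p q : K -> R[i]) (k : K) : R[i] :=
  cintegral muK (fun s => p s * q (s^-1 * k)%g).

Definition section_at (f : semidirect tau -> R[i]) (t : H) : K -> R[i] :=
  fun k => f (t, k).

Definition tau_conv (f g : semidirect tau -> R[i]) (x : semidirect tau)
    : R[i] :=
  cintegral muH
    (fun t =>
       group_conv (section_at f t) (section_at g x.1) x.2 * (delta t)%:C).

(* cintegral is total; this is the absolute convergence of the two integrals
   in tau_conv f g x. *)
Definition tau_conv_converges (f g : semidirect tau -> R[i])
    (x : semidirect tau) : Prop :=
  {ae muH, forall t,
     cintegrable muK (fun s => f (t, s) * g (x.1, (s^-1 * x.2)%g))} /\
  cintegrable muH
    (fun t =>
       group_conv (section_at f t) (section_at g x.1) x.2 * (delta t)%:C).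

Definition is_tau_convolution mu (op : L1 mu -> L1 mu -> L1 mu) : Prop :=
  forall f g : L1fun mu,
    {ae mu, forall x, tau_conv_converges f g x /\
       L1repr (op (L1class f) (L1class g)) x = tau_conv f g x}.
End TauConvolution.

Definition banach_algebra (C : numFieldType) (A : normedModType C)
    (op : A -> A -> A) : Prop :=
  [/\ forall F : set_system A, ProperFilter F -> cauchy F -> cvg F,
      (forall x, linear (op x)) /\ (forall y, linear (op^~ y)),
      associative op
    & forall x y, `|op x y| <= `|x| * `|y|].

(* Main.v *)
Require Import Defs.
From mathcomp Require Import all_boot all_order all_algebra.
From mathcomp Require Import all_classical all_reals all_analysis.
From HB Require Import structures.
From mathcomp Require Import measurable_realfun complex ring_quotient ring lra.

Set Implicit Arguments.
Unset Strict Implicit.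
Unset Printing Implicit Defensive.

Import Order.TTheory GRing.Theory Num.Theory.
Import numFieldNormedType.Exports Normc.

Local Open Scope classical_set_scope.
Local Open Scope ring_scope.

(* Writing [P f (s) = \int f (t, s) delta t dt], the convolution is
   [(f * g) (h, k) = \int (P f) (s) g (h, s^-1 k) ds], and [P] maps it to the
   convolution of [P f] and [P g] on [K].  For nonnegative functions,
   associativity and the norm identity [|f * g| = |f| |g|] then follow from
   Tonelli's theorem and the left invariance of [dk]; the complex case follows
   by bilinearity, every class being a linear combination of nonnegative ones.

   The difficulty is that the Borel sets of a product may exceed the product
   sigma-algebra, and that the Haar measures need not be sigma-finite.  The
   first point is met by proving Tonelli's theorem on open sets, by inner
   regularity, and extending it to Borel sets by uniqueness of measures.  For
   the second, an integrable function vanishes (everywhere, not just almost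
   everywhere) off a product of open sigma-compact subgroups, since an open
   set of finite measure is contained in the closure of a sigma-compact set. *)

(** * Functionals that behave like integrals *)

(** The integrals defining the convolution may diverge on a null set of points, where [cintegral]
    takes default values, so associativity of the complex convolution cannot be read off point by
    point. The convolution [conv] with values in [[0, +oo]] is associative at every point, and the
    complex one agrees with it on nonnegative functions wherever it is finite, hence almost
    everywhere by the norm identity. Inside an iterated convolution this agreement is only an
    almost-everywhere statement about one argument, so [conv] has to respect almost-everywhere
    equality in each argument. Since infinite values forbid subtraction, [ae_eq_absorber] adds an
    infinite function supported on a null set instead.

    The supports are enlarged to subgroups so that one product of [A] and [B] carries the given
    functions and all their iterated convolutions. An open subgroup is also closed, so its
    complement is an open set that the restricted Haar measure ignores; this makes the restricted
    measure sigma-finite by open sets of the whole group. *)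

Section IntegralLike.
Local Open Scope ereal_scope.
Context d (Z : measurableType d) (R : realType).
Implicit Types (L : (Z -> \bar R) -> \bar R) (f g : Z -> \bar R).

Definition ge0_mfun f := measurable_fun setT f /\ forall z, 0 <= f z.

(** The common features of integrals against a measure and of weighted iterated integrals on the
    Borel sets of a product, where the latter are not yet known to come from a measure. Monotone
    convergence is the clause that encodes countable additivity. *)
Definition integral_like L := [/\
  forall f g, ge0_mfun f -> ge0_mfun g -> L (f \+ g) = L f + L g,
  forall (r : R) f, (0 <= r)%R -> ge0_mfun f ->
    L (fun z => r%:E * f z) = r%:E * L f
  & forall h : nat -> Z -> \bar R, (forall n, ge0_mfun (h n)) ->
      (forall z, nondecreasing_seq (h ^~ z)) ->
      L (fun z => limn (h ^~ z)) = limn (fun n => L (h n))].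

Lemma ge0_mfun_indic (A : set Z) : measurable A ->
  ge0_mfun (fun z => (\1_A z)%:E).
Proof. by move=> mA; split=> [|z]; [exact/measurable_EFinP|rewrite lee_fin]. Qed.

Lemma ge0_mfunZ (r : R) f : (0 <= r)%R -> ge0_mfun f ->
  ge0_mfun (fun z => r%:E * f z).
Proof.
by move=> r0 [mf f0]; split=> [|z]; [exact: measurable_funeM|rewrite mule_ge0].
Qed.

Lemma ge0_mfunM f g : ge0_mfun f -> ge0_mfun g -> ge0_mfun (fun z => f z * g z).
Proof.
by move=> [mf f0] [mg g0]; split=> [|z]; [exact: emeasurable_funM|rewrite mule_ge0].
Qed.

Lemma ge0_mfun_sum (I : Type) (s : seq I) (h : I -> Z -> \bar R) :
  (forall i, ge0_mfun (h i)) -> ge0_mfun (fun z => \sum_(i <- s) h i z).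
Proof.
move=> mh; split=> [|z]; last by apply: sume_ge0 => i _; case: (mh i).
by apply: emeasurable_sum => i; case: (mh i).
Qed.

Lemma integral_like_sum L (I : Type) (s : seq I) (h : I -> Z -> \bar R) :
  integral_like L -> (forall i, ge0_mfun (h i)) ->
  L (fun z => \sum_(i <- s) h i z) = \sum_(i <- s) L (h i).
Proof.
move=> [LD LZ _] mh; elim: s => [|i s IH].
  under eq_fun do rewrite big_nil; rewrite big_nil.
  rewrite -[RHS](mul0e (L (cst 0))) -LZ//.
  by congr (L _); apply/funext => z; rewrite mul0e.
under eq_fun do rewrite big_cons; rewrite big_cons.
rewrite -IH (LD (h i) (fun z => \sum_(i <- s) h i z))//.
exact: ge0_mfun_sum.
Qed.

Import HBNNSimple.

Lemma integral_like_eq L1 L2 f : integral_like L1 -> integral_like L2 ->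
  (forall A, measurable A -> L1 (fun z => (\1_A z)%:E) = L2 (fun z => (\1_A z)%:E)) ->
  ge0_mfun f -> L1 f = L2 f.
Proof.
move=> L1L L2L L12 [mf f0].
have simple (h : {nnsfun Z >-> R}) : L1 (EFin \o h) = L2 (EFin \o h).
  pose s := finmap.enum_fset (fset_set (range h)).
  (* Truncating at 0 changes no value taken by [h], but it makes every summand nonnegative for all
     [r], as [integral_like_sum] asks of the whole family. *)
  have -> : EFin \o h = fun z => \sum_(r <- s) (Num.max r 0)%:E * (\1_(h @^-1` [set r]) z)%:E.
    apply/funext => z /=; rewrite fimfunE fsbig_finite//= -sumEFin.
    apply: eq_big_seq => r.
    rewrite in_fset_set// inE => -[y _ <-].
    by rewrite EFinM (max_idPl _).
  have mh r : measurable (h @^-1` [set r]) by [].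
  have m0 r : (0 <= Num.max r (0:R))%R by rewrite le_max lexx orbT.
  rewrite !integral_like_sum//; last 2 first.
  - by move=> r; apply: ge0_mfunZ => //; exact: ge0_mfun_indic.
  - by move=> r; apply: ge0_mfunZ => //; exact: ge0_mfun_indic.
  apply: eq_bigr => r _; case: L1L => _ L1Z _; case: L2L => _ L2Z _.
  by rewrite L1Z ?L2Z ?L12//; exact: ge0_mfun_indic.
pose f_ := nnsfun_approx measurableT mf.
have -> : f = fun z => limn (fun n => (f_ n z)%:E).
  by apply/funext => z; apply/esym/cvg_lim => //; exact: cvg_nnsfun_approx.
have gf n : ge0_mfun (fun z => (f_ n z)%:E).
  by split=> [|z]; [exact/measurable_EFinP|rewrite lee_fin].
have ndf z : nondecreasing_seq (fun n => (f_ n z)%:E).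
  by move=> a b ab; rewrite lee_fin; exact/lefP/nd_nnsfun_approx.
case: L1L => _ _ L1m; case: L2L => _ _ L2m.
rewrite (L1m (fun n z => (f_ n z)%:E))// (L2m (fun n z => (f_ n z)%:E))//.
by congr (limn _); apply/funext => n; exact: simple.
Qed.

Lemma integral_like_integral (m : {measure set Z -> \bar R}) :
  integral_like (fun f => \int[m]_z f z).
Proof.
split=> [f g [mf f0] [mg g0]|r f r0 [mf f0]|h mh ndh].
- by rewrite ge0_integralD.
- by rewrite ge0_integralZl_EFin.
- by rewrite monotone_convergence// => [n|n z _]; case: (mh n).
Qed.
End IntegralLike.

(** * Borel sets of product spaces *)

HB.instance Definition _ (X Y : ptopologicalType) := Topological.on (X * Y)%type.
HB.instance Definition _ (X Y : ptopologicalType) := Pointed.on (X * Y)%type.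

Lemma measurable_borel_open (T : ptopologicalType) (U : set T) :
  open U -> measurable (U : set (borel T)).
Proof. by move=> oU; exact: sub_sigma_algebra. Qed.

Lemma measurable_borel_closed (T : ptopologicalType) (C : set T) :
  closed C -> measurable (C : set (borel T)).
Proof.
move=> cC; rewrite -(setCK C); apply: measurableC.
by apply: measurable_borel_open; exact: closed_openC.
Qed.

Lemma measurable_borel_compact (T : ptopologicalType) (C : set T) :
  hausdorff_space T -> compact C -> measurable (C : set (borel T)).
Proof. by move=> hT cC; apply: measurable_borel_closed; exact: compact_closed. Qed.

Lemma continuous_borel_measurable (S T : ptopologicalType) (f : S -> T) :
  continuous f -> measurable_fun setT (f : borel S -> borel T).
Proof.
move=> cf; apply: (@measurability _ _ (borel S) (borel T) setT f (@open T)) => // _ [U oU <-].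
by rewrite setTI; apply: measurable_borel_open; exact: open_comp.
Qed.

Section Sections.
Context (X Y : ptopologicalType).

Lemma continuous_pairl (y : Y) : continuous (fun x : X => (x, y)).
Proof. by move=> x; apply: cvg_pair; [exact: cvg_id|exact: cvg_cst]. Qed.

Lemma continuous_pairr (x : X) : continuous (fun y : Y => (x, y)).
Proof. by move=> y; apply: cvg_pair; [exact: cvg_cst|exact: cvg_id]. Qed.

Lemma open_sectionr (U : set (X * Y)) (x : X) : open U -> open [set y | U (x, y)].
Proof.
by move=> oU; apply: (@open_comp _ _ (fun y => (x, y))) => // y _; exact: continuous_pairr.
Qed.

Lemma measurable_sectionr (E : set (X * Y)) (x : X) :
  measurable (E : set (borel (X * Y)%type)) ->
  measurable ([set y | E (x, y)] : set (borel Y)).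
Proof.
move=> mE; have := @continuous_borel_measurable Y (X * Y)%type _ (continuous_pairr (x := x)).
by move=> /(_ measurableT _ mE); rewrite setTI.
Qed.

End Sections.

(** * Inner regularity and the measure of sections *)

Section InnerRegular.
Context (R : realType) (T : ptopologicalType).
Implicit Type nu : {measure set (borel T) -> \bar R}.
Local Open Scope ereal_scope.

Definition inner_open nu := forall U : set T, open U ->
  nu U = ereal_sup [set nu C | C in [set C : set T | compact C /\ C `<=` U]].

(** The pieces are open so that they belong to the family of open sets on which two measures are
    compared, and increasing so that the pieces of two factors can share one index. *)
Definition open_sigma_finite nu := exists P : nat -> set T,
  [/\ forall n, open (P n), nondecreasing_seq P, \bigcup_n P n = setT
    & forall n, nu (P n) < +oo].
End InnerRegular.

Section NearSection.
Context (R : realType) (X Y : ptopologicalType).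
Hypothesis hY : hausdorff_space Y.
Variable nu : {measure set (borel Y) -> \bar R}.
Hypothesis nuI : inner_open nu.
Local Open Scope ereal_scope.

(* A tube lemma: for constant [W] it says that [x |-> nu U_x] is lower
   semicontinuous; with [W] ranging over a directed family exhausting [U] it
   approximates [nu U_x] from below, locally uniformly in [x]. *)
Lemma near_section_gt (I : Type) (F : set_system I) (FF : Filter F)
    (W : I -> set (X * Y)) (U : set (X * Y)) (x : X) (c : \bar R) :
  open U -> (forall i, open (W i)) ->
  (forall z, U z -> \forall z' \near z & i \near F, W i z') ->
  c < nu [set y | U (x, y)] ->
  \forall x' \near x & i \near F, c < nu [set y | W i (x', y)].
Proof.
move=> oU oW UW; rewrite (nuI (open_sectionr x oU)) => /ereal_sup_gt[_ [C [cC CU] <-]] cC'.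
have /compact_near_coveringP := cC => /(_ (X * I)%type (filter_prod (nbhs x) F)
  (fun j y => W j.2 (j.1, y)) _) H.
have {}H : \forall j \near filter_prod (nbhs x) F, C `<=` (fun y => W j.2 (j.1, y)).
  apply: H => y /CU /UW [[A B] /= [[[A1 A2] /= [xA1 yA2] A12] FB] AB].
  exists (A2, A1 `*` B) => /=; first by split=> //; exists (A1, B).
  by move=> [y' [x' i]] /= [A2y' [A1x' Bi]]; apply: (AB ((x', y'), i)); split=> //; exact: A12.
apply: filterS H => -[x' i] /= CW; apply: (lt_le_trans cC').
apply: le_measure => //; rewrite inE; first exact: measurable_borel_compact.
by apply: measurable_borel_open; exact: open_sectionr.
Qed.

Lemma open_section_gt (U : set (X * Y)) (c : \bar R) : open U ->
  open [set x | c < nu [set y | U (x, y)]].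
Proof.
move=> oU; rewrite openE => x /= cx.
have [||[A B] /= [xA B1] AB] := @near_section_gt unit (globally setT) _ (fun=> U) U x c oU _ _ cx.
- by [].
- move=> z Uz; exists (U, setT) => /=; last by move=> ? [].
  by split=> //; exact: open_nbhs_nbhs.
- by apply: filterS xA => x' Ax'; apply: (AB (x', tt)); split=> //; exact: B1.
Qed.

Lemma measurable_open_section (U : set (X * Y)) : open U ->
  measurable_fun setT (fun x : borel X => nu [set y | U (x, y)]).
Proof.
move=> oU; apply: (measurability _ (ErealGenOInfty.measurableE R)) => // _ [_ [r ->] <-].
rewrite setTI; apply: measurable_borel_open.
rewrite (_ : _ @^-1` _ = [set x | r%:E < nu [set y | U (x, y)]]).
  exact: open_section_gt.
by apply/seteqP; split=> x /=; rewrite in_itv/= andbT.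
Qed.

End NearSection.

Section MeasurableSection.
Context (R : realType) (X Y : ptopologicalType).
Hypothesis hY : hausdorff_space Y.
Variable nu : {measure set (borel Y) -> \bar R}.
Hypothesis nuI : inner_open nu.
Hypothesis nuF : open_sigma_finite nu.
Local Open Scope ereal_scope.

(** Dynkin's argument starting from open sets, whose sections vary semicontinuously. Cutting with
    [Q], of finite measure, makes the subtraction in the complement step legitimate. *)
Lemma measurable_section_finite (Q : set Y) (E : set (borel (X * Y)%type)) :
  open Q -> nu Q < +oo -> measurable E ->
  measurable_fun setT (fun x : borel X => nu ([set y | E (x, y)] `&` Q)).
Proof.
move=> oQ Qoo mE; have mQ := measurable_borel_open oQ.
have fQ (A : set (borel Y)) : measurable A -> nu (A `&` Q) < +oo.
  move=> mA; apply: le_lt_trans Qoo; apply: le_measure; rewrite ?inE//.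
  exact: measurableI.
move: E mE; apply: (@dynkin_induction _ (borel (X * Y)%type) open
   (fun E => measurable_fun setT (fun x : borel X => nu ([set y | E (x, y)] `&` Q)))) => //.
- by move=> A B; exact: openI.
- by rewrite (_ : (fun _ => _) = cst (nu Q))//; apply/funext => x; rewrite setTI.
- move=> U oU.
  have oUQ : open (U `&` snd @^-1` Q).
    by apply: openI => //; apply: open_comp => // ? _; exact: cvg_snd.
  exact: (measurable_open_section hY nuI oUQ).
- move=> S mS HS.
  rewrite (_ : (fun _ => _) = fun x => nu Q - nu ([set y | S (x, y)] `&` Q)).
    by apply: emeasurable_funB.
  apply/funext => x; rewrite setIC [X in _ - nu X]setIC -measureD ?setDE//.
  exact: measurable_sectionr.
- move=> F mF tF HF.
  rewrite (_ : (fun _ => _) = fun x => \sum_(0 <= k <oo) nu ([set y | F k (x, y)] `&` Q)).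
    by apply: ge0_emeasurable_sum.
  apply/funext => x; rewrite -measure_semi_bigcup.
  + by congr (nu _); rewrite -setI_bigcupl.
  + by move=> k; apply: measurableI => //; exact: measurable_sectionr.
  + apply/trivIsetP => i j _ _ ij; apply/seteqP; split=> // y [[Fi _] [Fj _]].
    by move/trivIsetP : tF => /(_ i j Logic.I Logic.I ij)/seteqP[+ _] => /(_ (x, y)); apply.
  + apply: bigcup_measurable => k _; apply: measurableI => //.
    exact: measurable_sectionr.
Qed.

Lemma measurable_section (E : set (borel (X * Y)%type)) : measurable E ->
  measurable_fun setT (fun x : borel X => nu [set y | E (x, y)]).
Proof.
move=> mE; have [P [oP ndP PT Poo]] := nuF.
apply: (emeasurable_fun_cvg (fun n (x : borel X) => nu ([set y | E (x, y)] `&` P n))).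
  by move=> n; exact: measurable_section_finite.
move=> x _.
rewrite -[X in nu X]setIT -PT setI_bigcupr.
have mEP n : measurable ([set y | E (x, y)] `&` P n : set (borel Y)).
  by apply: measurableI; [exact: measurable_sectionr|exact: measurable_borel_open].
apply: nondecreasing_cvg_mu => //; first exact: bigcup_measurable.
by move=> m n mn; apply/subsetPset; apply: setIS; exact/subsetPset/ndP.
Qed.

Lemma measurable_fun_sectionr (f : X * Y -> \bar R) (x : X) :
  measurable_fun setT (f : borel (X * Y)%type -> \bar R) ->
  measurable_fun setT (fun y : borel Y => f (x, y)).
Proof.
move=> mf; apply: measurableT_comp mf _.
exact: (@continuous_borel_measurable Y (X * Y)%type _ (@continuous_pairr X Y x)).
Qed.

(** The integral over a section is the integral of [f] against the image of [nu] under
    [y |-> (x, y)]. By [measurable_section] these image measures form a kernel in [x], and integrals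
    against a kernel are measurable. *)
Lemma ge0_measurable_integral_section (f : X * Y -> \bar R) :
  ge0_mfun (f : borel (X * Y)%type -> \bar R) ->
  measurable_fun setT (fun x : borel X => \int[nu]_y f (x, y)).
Proof.
move=> [mf f0].
have mp x := @continuous_borel_measurable Y (X * Y)%type _ (@continuous_pairr X Y x).
rewrite (_ : (fun _ => _) =
    fun x => \int[pushforward nu ((fun y => (x, y)) : borel Y -> borel (X * Y)%type)]_z f z).
  by apply: measurable_fun_integral_kernel => // E mE; exact: measurable_section.
apply/funext => x; rewrite [RHS](ge0_integral_pushforward (mp x))//.
Qed.

Lemma integral_like_iterated (mu : {measure set (borel X) -> \bar R}) (w : X -> R) :
  measurable_fun setT (w : borel X -> R) -> (forall x, 0 <= w x)%R ->
  integral_like (fun f : borel (X * Y)%type -> \bar R =>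
    \int[mu]_x (\int[nu]_y f (x, y) * (w x)%:E)).
Proof.
move=> mw w0.
have mwE : ge0_mfun (fun x : borel X => (w x)%:E).
  by split=> [|x]; [exact/measurable_EFinP|rewrite lee_fin].
have mI (f : borel (X * Y)%type -> \bar R) : ge0_mfun f ->
    ge0_mfun (fun x : borel X => \int[nu]_y f (x, y)).
  move=> mf; split; first exact: (ge0_measurable_integral_section mf).
  by move=> x; apply: integral_ge0 => y _; exact: mf.2.
have mIw (f : borel (X * Y)%type -> \bar R) : ge0_mfun f ->
    ge0_mfun (fun x : borel X => \int[nu]_y f (x, y) * (w x)%:E).
  by move=> mf; apply: ge0_mfunM => //; exact: mI.
split=> [f g mf mg|r f r0 mf|h mh ndh].
- have [mIf If0] := mIw _ mf; have [mIg Ig0] := mIw _ mg.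
  rewrite -ge0_integralD//; apply: eq_integral => x _.
  case: mf mg => [mf f0] [mg g0].
  rewrite ge0_integralD//; try exact: measurable_fun_sectionr.
  by rewrite ge0_muleDl//; exact: integral_ge0.
- have [mIf If0] := mIw _ mf.
  rewrite -ge0_integralZl_EFin//; apply: eq_integral => x _.
  case: mf => mf f0.
  rewrite ge0_integralZl_EFin//; last exact: measurable_fun_sectionr.
  by rewrite muleA.
- have mh' n : measurable_fun setT (h n) by case: (mh n).
  have h0 n z : 0 <= h n z by case: (mh n).
  rewrite -monotone_convergence//; last 3 first.
  + by move=> n; case: (mIw _ (mh n)).
  + by move=> n x _; case: (mIw _ (mh n)).
  + move=> x _ m n mn; apply: lee_wpmul2r; first by rewrite lee_fin.
    apply: ge0_le_integral => //; try exact: measurable_fun_sectionr.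
    by move=> y _; exact: ndh.
  apply: eq_integral => x _.
  rewrite monotone_convergence//; last by move=> n; exact: measurable_fun_sectionr.
  rewrite muleC -limeMl//; last first.
    apply: ereal_nondecreasing_is_cvgn => m n mn.
    apply: ge0_le_integral => //; try exact: measurable_fun_sectionr.
    by move=> y _; exact: ndh.
  by congr (limn _); apply/funext => n; rewrite muleC.
Qed.
End MeasurableSection.

(** Countable additivity is the monotone convergence clause applied to the partial sums of the
    indicators of disjoint sets. The point is to bring iterated integrals within reach of the
    uniqueness theorem for measures. *)
Lemma integral_like_measure d (Z : measurableType d) (R : realType)
    (L : (Z -> \bar R) -> \bar R) :
  integral_like L -> (forall f, ge0_mfun f -> (0 <= L f)%E) ->
  exists m : {measure set Z -> \bar R},
    forall A, measurable A -> m A = L (fun z => (\1_A z)%:E).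
Proof.
move=> LL L0; have [_ LZ Lm] := LL.
(* A measure is a total function on sets, so [0] is assigned off the sigma-algebra. *)
pose lam (A : set Z) : \bar R := if `[< measurable A >] then L (fun z => (\1_A z)%:E) else 0%E.
have lamE A : measurable A -> lam A = L (fun z => (\1_A z)%:E).
  by move=> mA; rewrite /lam asboolT.
have lam0 : lam set0 = 0%E.
  rewrite lamE//; transitivity (L (fun z => 0%:E * cst 0 z)%E).
    by congr (L _); apply/funext => z; rewrite mul0e indic0.
  by rewrite LZ// mul0e.
have lam_ge0 A : (0 <= lam A)%E.
  by rewrite /lam; case: asboolP => // mA; exact/L0/ge0_mfun_indic.
have lamS : semi_sigma_additive lam.
  move=> F mF tF mUF.
  have -> : (fun n => \sum_(0 <= i < n) lam (F i))%E =
      (fun n => L (fun z => \sum_(0 <= i < n) (\1_(F i) z : R)%:E)%E).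
    apply/funext => n.
    rewrite (integral_like_sum (index_iota 0 n) LL
      (h := fun i z => (\1_(F i) z : R)%:E)).
      by apply: eq_bigr => i _; rewrite lamE.
    by move=> i; exact: ge0_mfun_indic.
  have mS n : ge0_mfun (fun z => \sum_(0 <= i < n) (\1_(F i) z : R)%:E)%E.
    by apply: ge0_mfun_sum => i; exact: ge0_mfun_indic.
  rewrite lamE// (_ : (fun z => (\1_(\bigcup_n F n) z)%:E) =
     fun z => limn (fun n => \sum_(0 <= i < n) (\1_(F i) z : R)%:E)%E); last first.
    by apply/funext => z; rewrite indic_bigcup.
  have ndS z : nondecreasing_seq (fun n => \sum_(0 <= i < n) (\1_(F i) z : R)%:E)%E.
    by move=> n p np; apply: lee_sum_nneg_natr => // i _ _; rewrite lee_fin.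
  rewrite (Lm (fun n z => \sum_(0 <= i < n) (\1_(F i) z : R)%:E)%E)//.
  apply: ereal_nondecreasing_is_cvgn => n p np.
  have [LD _ _] := LL.
  rewrite (_ : (fun z => \sum_(0 <= i < p) _)%E = (fun z => \sum_(0 <= i < n) (\1_(F i) z : R)%:E)%E
      \+ (fun z => \sum_(n <= i < p) (\1_(F i) z : R)%:E)%E)%E; last first.
    by apply/funext => z /=; rewrite -big_cat_nat.
  have mS' : ge0_mfun (fun z => \sum_(n <= i < p) (\1_(F i) z : R)%:E)%E.
    by apply: ge0_mfun_sum => i; exact: ge0_mfun_indic.
  by rewrite LD// leeDl// L0.
pose m : {measure set Z -> \bar R} := HB.pack lam (isMeasure.Build _ _ _ lam lam0 lam_ge0 lamS).
by exists m => A mA; rewrite -lamE.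
Qed.

(** * A discrete layer-cake formula *)

Section Layers.
Context (R : realType).
Implicit Types (b : \bar R) (e : R).
Local Open Scope ereal_scope.

(** The sum is [e] times the number of levels [e, 2e, ..., N e] lying strictly below [b]: a rounding
    of [b] down to a multiple of [e], capped at [N e]. With [layer_ge] it brackets [b] up to an
    error [e] as long as the cap is not exceeded. *)
Lemma layer_le b e N : 0 <= b -> (0 <= e)%R ->
  \sum_(j < N) (e * ((j.+1%:R * e)%:E < b)%E%:R)%:E <= b.
Proof.
move=> b0 e0; elim: N => [|N IH]; first by rewrite big_ord0.
rewrite big_ord_recr/=; have [Nb|_] := ltP (N.+1%:R * e)%:E b; last by rewrite mulr0 adde0.
apply: le_trans (ltW Nb); rewrite mulr1.
have : \sum_(i < N) (e * ((i.+1%:R * e)%:E < b)%E%:R)%:E <= \sum_(i < N) e%:E.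
  apply: lee_sum => i _; by rewrite lee_fin ler_piMr// lern1 leq_b1.
move=> /(leeD2r e%:E) /le_trans; apply.
by rewrite sumEFin sumr_const card_ord -EFinD lee_fin -mulrSr mulr_natl.
Qed.

Lemma layer_ge b e N : 0 <= b -> (0 <= e)%R -> b <= (N%:R * e)%:E ->
  b <= e%:E + \sum_(j < N) (e * ((j.+1%:R * e)%:E < b)%E%:R)%:E.
Proof.
move=> b0 e0; elim: N => [|N IH] bN.
  by rewrite big_ord0 adde0 (le_trans bN)// mul0r lee_fin.
rewrite big_ord_recr/=; have [bN'|Nb] := leP b (N%:R * e)%:E.
  apply: (le_trans (IH bN')); rewrite leeD2l// leeDl// lee_fin.
  by rewrite mulr_ge0// ler0n.
apply: (le_trans bN).
rewrite (eq_bigr (fun=> e%:E)); last first.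
  move=> i _; rewrite (_ : _ < _) ?mulr1//; apply: le_lt_trans Nb.
  by rewrite lee_fin ler_wpM2r// ler_nat.
rewrite sumEFin sumr_const card_ord -!EFinD lee_fin.
rewrite mulr_natl mulrS lerD2l lerDl; exact: mulr_ge0.
Qed.
End Layers.

(** * Tonelli's theorem for Radon measures *)

(** Supplies the bundled sigma-finite measures over which [indic_fubini_tonelli] is stated. Being an
    equation, it can be used to replace [m] in a goal. *)
Lemma sigma_finite_packed d (T : measurableType d) (R : realType)
    (m : {measure set T -> \bar R}) : sigma_finite setT m ->
  exists m' : {sigma_finite_measure set T -> \bar R},
    (m' : {measure set T -> \bar R}) = m.
Proof.
move=> sm.
pose H1 := isSFinite.Build _ _ _ m (sfinite_measure_sigma_finite sm).
pose H2 := isSigmaFinite.Build _ _ _ m sm.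
pose m' := HB.pack_for (SigmaFiniteMeasure.type T R) (Measure.sort m) H1 H2.
by exists m'; exact: eq_measure.
Qed.

Lemma open_setX (X Y : topologicalType) (A : set X) (B : set Y) :
  open A -> open B -> open (A `*` B).
Proof.
move=> oA oB; apply: (@openI _ (fst @^-1` A) (snd @^-1` B)).
  by apply: open_comp => // z _; exact: cvg_fst.
by apply: open_comp => // z _; exact: cvg_snd.
Qed.

Lemma le_measure_open (R : realType) (T : ptopologicalType)
    (m : {measure set (borel T) -> \bar R}) (A B : set T) :
  open A -> open B -> A `<=` B -> (m A <= m B)%E.
Proof. by move=> oA oB AB; apply: le_measure; rewrite ?inE//; exact: measurable_borel_open. Qed.

Section OpenTonelli.
Context (R : realType) (X Y : ptopologicalType).
Hypothesis hX : hausdorff_space X.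
Hypothesis hY : hausdorff_space Y.
Variable mu : {measure set (borel X) -> \bar R}.
Variable nu : {measure set (borel Y) -> \bar R}.
Hypothesis muI : inner_open mu.
Hypothesis muF : open_sigma_finite mu.
Hypothesis nuI : inner_open nu.
Hypothesis nuF : open_sigma_finite nu.
Local Open Scope ereal_scope.

Lemma sigma_finite_open (T : ptopologicalType) (m : {measure set (borel T) -> \bar R}) :
  open_sigma_finite m -> sigma_finite setT m.
Proof.
move=> [P [oP _ PT Poo]]; exists P; first by rewrite PT.
by move=> n; split=> //; exact: measurable_borel_open.
Qed.

Lemma tonelli_prod_measurable (V : set (X * Y)) :
  measurable (V : set (borel X * borel Y)) ->
  \int[mu]_x nu [set y | V (x, y)] = \int[nu]_y mu [set x | V (x, y)].
Proof.
move=> mV.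
have [m1 <-] := sigma_finite_packed (sigma_finite_open muF).
have [m2 <-] := sigma_finite_packed (sigma_finite_open nuF).
have := indic_fubini_tonelli m1 m2 mV.
rewrite (indic_fubini_tonelli_FE m2 mV) (indic_fubini_tonelli_GE m1 mV).
have xE x : xsection V x = [set y | V (x, y)].
  by apply/seteqP; split=> y; rewrite /xsection/= inE.
have yE y : ysection V y = [set x | V (x, y)].
  by apply/seteqP; split=> x; rewrite /ysection/= inE.
under eq_integral do rewrite /= xE.
by under [RHS]eq_integral do rewrite /= yE.
Qed.

Let open_sectionl (U : set (X * Y)) (y : Y) : open U -> open [set x | U (x, y)].
Proof.
by move=> oU; apply: (@open_comp _ _ (fun x => (x, y))) => // x _; exact: continuous_pairl.
Qed.

(* Inside an open set of finite measure, the layers of [x |-> nu U_x] are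
   nearly exhausted by compact sets, over which [U] may be replaced by one
   finite union [V] of open rectangles; for [V] the product sigma-algebra
   suffices. *)
Lemma tonelli_open_le (U : set (X * Y)) (P : set X) (Q : set Y) :
  open U -> open P -> open Q -> mu P < +oo -> nu Q < +oo -> U `<=` P `*` Q ->
  \int[mu]_x nu [set y | U (x, y)] <= \int[nu]_y mu [set x | U (x, y)].
Proof.
move=> oU oP oQ Poo Qoo UPQ.
pose good (V : set (X * Y)) := [/\ open V, V `<=` U &
  measurable (V : set (borel X * borel Y))].
pose I := {V | good V}.
have gU V W : good V -> good W -> good (V `|` W).
  move=> [oV VU mV] [oW WU mW]; split; [exact: openU| |exact: measurableU].
  by move=> z [/VU|/WU].
have gR (A : set X) (B : set Y) : open A -> open B -> A `*` B `<=` U -> good (A `*` B).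
  move=> oA oB AB; split=> //; first exact: open_setX.
  by apply: measurableX; exact: measurable_borel_open.
have g0 : good set0 by split=> //; exact: open0.
(* The tails of the sets [V] for inclusion. Any two [V] are contained in a third, their union, and
   each point of [U] has a rectangular neighbourhood inside [U], so along [F] the sets [V] exhaust
   [U] locally uniformly, as [near_section_gt] requires. *)
pose F : set_system I := filter_from setT
  (fun V0 : I => [set V : I | sval V0 `<=` sval V]).
have FF : ProperFilter F.
  apply: filter_from_proper; last by move=> V _; exists V => /=.
  apply: filter_from_filter; first by by exists (exist _ set0 g0).
  move=> V W _ _; exists (exist _ _ (gU _ _ (svalP V) (svalP W))) => //.
  by move=> Z /= VWZ; split=> z Hz; apply: VWZ; [left|right].
have near_rect z : U z -> \forall z' \near z & V \near F, sval V z'.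
  move=> Uz; have [[A B] /= [Az Bz] AB] : nbhs z U by exact: open_nbhs_nbhs.
  have Az' : nbhs z.1 A^° by exact: nbhs_interior.
  have Bz' : nbhs z.2 B^° by exact: nbhs_interior.
  have gV : good (A^° `*` B^°).
    apply: gR; [exact: open_interior|exact: open_interior|].
    by move=> t [/interior_subset At /interior_subset Bt]; exact: AB.
  exists (A^° `*` B^°, [set V : I | A^° `*` B^° `<=` sval V]) => /=.
    split; first by exists (A^°, B^°).
    by exists (exist _ _ gV).
  by move=> [t V] /= [ABt]; exact.
set B := \int[nu]_y _.
have VB (V : I) : \int[mu]_x nu [set y | sval V (x, y)] <= B.
  have [oV VU mV] := svalP V.
  rewrite tonelli_prod_measurable//; apply: ge0_le_integral => //.
  - have oV' : open [set z : Y * X | sval V (z.2, z.1)].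
      apply: (@open_comp _ _ (fun z : Y * X => (z.2, z.1))) => // z _.
      by apply: cvg_pair; [exact: cvg_snd|exact: cvg_fst].
    exact: (measurable_open_section hX muI oV').
  - have oU' : open [set z : Y * X | U (z.2, z.1)].
      apply: (@open_comp _ _ (fun z : Y * X => (z.2, z.1))) => // z _.
      by apply: cvg_pair; [exact: cvg_snd|exact: cvg_fst].
    exact: (measurable_open_section hX muI oU').
  - move=> y _; apply: le_measure_open; [exact: open_sectionl|exact: open_sectionl|].
    by move=> x; exact: VU.
pose phi (x : X) := nu [set y | U (x, y)].
have phiQ x : phi x <= nu Q.
  apply: le_measure_open => //; first exact: open_sectionr.
  by move=> y /UPQ[].
have phiP x : ~ P x -> phi x = 0.
  move=> Px; rewrite /phi (_ : [set _ | _] = set0)// -subset0 => y /UPQ[/=].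
  by move=> /Px.
have finP : mu P \is a fin_num by rewrite ge0_fin_numE.
have finQ : nu Q \is a fin_num by rewrite ge0_fin_numE.
apply/lee_addgt0Pr => e e0.
(* Error budget: rounding [phi] to layers of height [d] costs at most [d * mu P], and replacing each
   of the [N] layers by a compact set costs [d / N], thus [d] altogether. The sum is
   [d * (mu P + 1) = e]. *)
pose d := (e / (fine (mu P) + 1))%R.
have P1 : (0 < fine (mu P) + 1)%R by rewrite ltr_wpDl// fine_ge0.
have d0 : (0 < d)%R by rewrite divr_gt0.
have dE : (d * (fine (mu P) + 1) = e)%R by rewrite /d divfK// gt_eqF.
clearbody d.
(* Enough layers to reach the upper bound [nu Q] of [phi]; the successor makes [N] positive, so that
   [1 / N] is a genuine tolerance below. *)
pose N := (Num.truncn (fine (nu Q) / d)).+1.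
have QN : nu Q <= (N%:R * d)%:E.
  rewrite -(fineK finQ) lee_fin -ler_pdivrMr// ltW//.
  by rewrite truncnS_gt.
pose O j := [set x | (j.+1%:R * d)%:E < phi x].
have oO j : open (O j) by exact: open_section_gt.
have OP j : O j `<=` P.
  move=> x; apply: contraPP => /phiP; rewrite /O/= => ->; rewrite lte_fin.
  by apply/negP; rewrite -leNgt mulr_ge0// ltW.
have mO j : measurable (O j : set (borel X)) by exact: measurable_borel_open.
have /choice[C HC] : forall j, exists C : set X,
    [/\ compact C, C `<=` O j & mu (O j) <= mu C + (N%:R^-1)%:E].
  move=> j; have Ooo : mu (O j) < +oo.
    by apply: le_lt_trans Poo; apply: le_measure_open => //; exact: OP.
  have fO : mu (O j) \is a fin_num by rewrite ge0_fin_numE.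
  have : mu (O j) - (N%:R^-1)%:E < mu (O j).
    by rewrite lteBlDr// lteDl// lte_fin invr_gt0 ltr0n.
  rewrite {2}(muI (oO j)) => /ereal_sup_gt[_ [C [cC CO] <-]] CC.
  by exists C; split=> //; rewrite -leeBlDr// ltW.
have mC j : measurable (C j : set (borel X)).
  by apply: measurable_borel_compact => //; case: (HC j).
(* Near each point of [C j] the inequality holds for all sufficiently large [V]. Compactness makes
   this uniform on [C j], and finitely many [j] leave a common [V] because [F] is proper. *)
have [V HV] : exists V : I, forall j : 'I_N,
    C j `<=` [set x | (j.+1%:R * d)%:E < nu [set y | sval V (x, y)]].
  apply: (@filter_ex _ F); apply: (@filter_forall _ _ (fun j : 'I_N => [set V : I |
    C j `<=` [set x | (j.+1%:R * d)%:E < nu [set y | sval V (x, y)]]]) F _) => j.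
  have [cC CO _] := HC j.
  move/compact_near_coveringP : cC => /(_ I F
    (fun V x => (j.+1%:R * d)%:E < nu [set y | sval V (x, y)])); apply.
  move=> x /CO Ojx; apply: (@near_section_gt R X Y hY nu nuI I F _ sval U) => //.
  by move=> V; case: (svalP V).
have mphi : measurable_fun setT (phi : borel X -> \bar R) by exact: measurable_open_section.
have mP : measurable (P : set (borel X)) by exact: measurable_borel_open.
have i0 (A : set (borel X)) x : 0 <= d%:E * (\1_A x)%:E.
  by rewrite mule_ge0// lee_fin// ltW.
have mi (A : set (borel X)) : measurable A -> measurable_fun setT (fun x => d%:E * (\1_A x)%:E).
  by move=> mA; apply: measurable_funeM; exact/measurable_EFinP.
have int1 (A : set (borel X)) : measurable A ->
    \int[mu]_x (d%:E * (\1_A x)%:E) = d%:E * mu A.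
  move=> mA; rewrite ge0_integralZl_EFin//; last 2 first.
  - exact/measurable_EFinP.
  - exact: ltW.
  by rewrite integral_indic// setIT.
have intS (A : nat -> set (borel X)) : (forall j, measurable (A j)) ->
    \int[mu]_x (\sum_(j < N) d%:E * (\1_(A j) x)%:E) = \sum_(j < N) d%:E * mu (A j).
  move=> mA; rewrite ge0_integral_sum//; last by move=> j; exact: mi.
  by apply: eq_bigr => j _; exact: int1.
have H1 : \int[mu]_x phi x <= d%:E * mu P + \sum_(j < N) d%:E * mu (O j).
  rewrite -int1// -intS// -ge0_integralD//; last 3 first.
  - exact: mi.
  - by move=> x _; apply: sume_ge0 => j _.
  - by apply: emeasurable_sum => j; exact: mi.
  apply: ge0_le_integral => //.
    apply: emeasurable_funD; first exact: mi.
    by apply: emeasurable_sum => j; exact: mi.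
  move=> x _; have [Px|Px] := pselect (P x); last first.
    by rewrite phiP// adde_ge0// sume_ge0.
  apply: le_trans (layer_ge _ (ltW d0) (le_trans (phiQ x) QN)) _ => //.
  rewrite indicE mem_set// mule1 leeD2l//; apply: lee_sum => j _.
  rewrite EFinM indicE lee_pmul2l//= lee_fin ler_nat.
  by have [H|//] := ltP; rewrite mem_set.
have H2 : \sum_(j < N) d%:E * mu (C j) <= B.
  apply: le_trans (VB V); rewrite -intS//; apply: ge0_le_integral => //.
  - by move=> x _; exact: sume_ge0.
  - by apply: emeasurable_sum => j; exact: mi.
  - by apply: measurable_open_section => //; case: (svalP V).
  move=> x _; apply: le_trans (layer_le N _ (ltW d0)) => //.
  apply: lee_sum => j _; rewrite -EFinM lee_fin ler_pM2l// indicE ler_nat.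
  by have [/set_mem/HV/= ->|] := boolP (x \in C j).
apply: (le_trans H1).
have : d%:E * mu P + \sum_(j < N) d%:E * mu (O j) <=
    d%:E * mu P + \sum_(j < N) (d%:E * mu (C j) + (d * N%:R^-1)%:E).
  rewrite leeD2l//; apply: lee_sum => j _; have [_ _ H] := HC j.
  by rewrite EFinM -ge0_muleDr ?lee_fin ?invr_ge0// lee_pmul2l.
move/le_trans; apply; rewrite big_split/= sumEFin sumr_const card_ord.
rewrite addeCA; apply: leeD => //.
rewrite -(fineK finP) -EFinM -EFinD lee_fin.
by rewrite -mulrnAr -mulr_natl divff ?pnatr_eq0// -mulrDr dE lexx.
Qed.
End OpenTonelli.

Lemma integral_like_restr d (Z : measurableType d) (R : realType)
    (m : {measure set Z -> \bar R}) (D : set Z) : measurable D ->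
  integral_like (fun f => \int[m]_(z in D) f z)%E.
Proof.
move=> mD; split=> [f g [mf f0] [mg g0]|r f r0 [mf f0]|h mh ndh].
- by rewrite ge0_integralD//; exact: measurable_funTS.
- by rewrite ge0_integralZl_EFin//; exact: measurable_funTS.
- rewrite monotone_convergence// => [n|n z _]; last by case: (mh n).
  by apply: measurable_funTS; case: (mh n).
Qed.

Lemma ge0_integral_mrestr d (Z : measurableType d) (R : realType)
    (m : {measure set Z -> \bar R}) (D : set Z) (mD : measurable D) (f : Z -> \bar R) :
  ge0_mfun f -> (\int[mrestr m mD]_z f z = \int[m]_(z in D) f z)%E.
Proof.
move=> mf; apply: (integral_like_eq (integral_like_integral (mrestr m mD))
  (integral_like_restr m mD)) => // A mA.
by rewrite !integral_indic// setIT.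
Qed.

Lemma ge0_integral_mrestr_support d (Z : measurableType d) (R : realType)
    (m : {measure set Z -> \bar R}) (D : set Z) (mD : measurable D) (f : Z -> \bar R) :
  ge0_mfun f -> (forall z, ~ D z -> f z = 0%E) ->
  (\int[mrestr m mD]_z f z = \int[m]_z f z)%E.
Proof.
move=> mf f0; rewrite ge0_integral_mrestr// integral_mkcond; apply: eq_integral => z _.
by rewrite patchE; case: ifPn => // /negP; rewrite inE => /f0.
Qed.

Section Tonelli.
Context (R : realType) (X Y : ptopologicalType).
Hypothesis hX : hausdorff_space X.
Hypothesis hY : hausdorff_space Y.
Variable mu : {measure set (borel X) -> \bar R}.
Variable nu : {measure set (borel Y) -> \bar R}.
Hypothesis muI : inner_open mu.
Hypothesis muF : open_sigma_finite mu.
Hypothesis nuI : inner_open nu.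
Hypothesis nuF : open_sigma_finite nu.
Local Open Scope ereal_scope.

Lemma continuous_swap (S T : topologicalType) : continuous (fun z : S * T => (z.2, z.1)).
Proof. by move=> z; apply: cvg_pair; [exact: cvg_snd|exact: cvg_fst]. Qed.

Lemma ge0_mfun_continuous (S T : ptopologicalType) (u : S -> T) (f : borel T -> \bar R) :
  continuous u -> ge0_mfun f -> ge0_mfun (fun s : borel S => f (u s)).
Proof.
move=> cu [mf f0]; split=> [|s]; last exact: f0.
by apply: measurableT_comp mf _; exact: continuous_borel_measurable.
Qed.

(** Both iterated integrals come from measures by [integral_like_measure]. These agree on open sets
    inside a box of finite measure by [tonelli_open_le], used once in each direction with the
    factors swapped, and such sets determine a Borel measure. *)
Lemma ge0_tonelli (f : X * Y -> \bar R) :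
  ge0_mfun (f : borel (X * Y)%type -> \bar R) ->
  \int[mu]_x \int[nu]_y f (x, y) = \int[nu]_y \int[mu]_x f (x, y).
Proof.
move=> mf.
pose L1 (f : borel (X * Y)%type -> \bar R) := \int[mu]_x \int[nu]_y f (x, y).
pose L2 (f : borel (X * Y)%type -> \bar R) := \int[nu]_y \int[mu]_x f (x, y).
have sw (g : borel (X * Y)%type -> \bar R) : ge0_mfun g ->
    ge0_mfun (fun z : borel (Y * X)%type => g (z.2, z.1)).
  exact: (@ge0_mfun_continuous (Y * X)%type (X * Y)%type _ _ (@continuous_swap _ _)).
have L1L : integral_like L1.
  have := @integral_like_iterated _ _ _ hY nu nuI nuF mu (cst 1%R) _ _.
  rewrite (_ : (fun _ => _) = L1); first by apply => // x; exact: ler01.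
  by apply/funext => g; apply: eq_integral => x _; rewrite mule1.
have L2L : integral_like L2.
  have := @integral_like_iterated _ _ _ hX mu muI muF nu (cst 1%R) _ _.
  rewrite (_ : (fun _ => _) = fun g : borel (Y * X)%type -> \bar R =>
     \int[nu]_y \int[mu]_x g (y, x)); last first.
    by apply/funext => g; apply: eq_integral => x _; rewrite mule1.
  move=> /(_ (measurable_cst _) (fun=> ler01)) [HD HZ Hm]; split.
  - by move=> g h mg mh; exact: (HD _ _ (sw _ mg) (sw _ mh)).
  - by move=> r g r0 mg; exact: (HZ r _ r0 (sw _ mg)).
  - move=> g mg ndg; apply: (Hm (fun n z => g n (z.2, z.1))) => [n|z].
      exact: sw.
    exact: ndg.
have L10 g : ge0_mfun g -> 0 <= L1 g.
  by move=> [_ g0]; apply: integral_ge0 => x _; exact: integral_ge0.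
have L20 g : ge0_mfun g -> 0 <= L2 g.
  by move=> [_ g0]; apply: integral_ge0 => y _; exact: integral_ge0.
have [m1 m1E] := integral_like_measure L1L L10.
have [m2 m2E] := integral_like_measure L2L L20.
have L1E (A : set (borel (X * Y)%type)) : measurable A ->
    L1 (fun z => (\1_A z)%:E) = \int[mu]_x nu [set y | A (x, y)].
  move=> mA; apply: eq_integral => x _.
  rewrite -[in RHS](setIT [set y | A (x, y)]) -integral_indic//.
  exact: measurable_sectionr.
have L2E (A : set (borel (X * Y)%type)) : measurable A ->
    L2 (fun z => (\1_A z)%:E) = \int[nu]_y mu [set x | A (x, y)].
  move=> mA; apply: eq_integral => y _.
  rewrite -[in RHS](setIT [set x | A (x, y)]) -integral_indic//.
  have := @continuous_borel_measurable X (X * Y)%type _ (@continuous_pairl X Y y).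
  by move=> /(_ measurableT _ mA); rewrite setTI.
apply: (integral_like_eq L1L L2L) => // A mA; rewrite -m1E// -m2E//.
have [P [oP ndP PT Poo]] := muF; have [Q [oQ ndQ QT Qoo]] := nuF.
(* A family stable under intersection that contains the boxes themselves. Every open set is the
   countable union of its traces on the boxes, so [G] generates the Borel sets. *)
pose G := [set U : set (X * Y) | open U /\ exists n, U `<=` P n `*` Q n].
have PQT : \bigcup_n (P n `*` Q n) = setT.
  rewrite -subTset => -[x y] _.
  have [n _ Pn] : (\bigcup_n P n) x by rewrite PT.
  have [m _ Qm] : (\bigcup_n Q n) y by rewrite QT.
  exists (maxn n m) => //; split => /=.
    by move: Pn; exact/subsetPset/ndP/leq_maxl.
  by move: Qm; exact/subsetPset/ndQ/leq_maxr.
have oPQ n : open (P n `*` Q n) by exact: open_setX.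
have m12 U : G U -> m1 U = m2 U.
  move=> [oU [n Un]]; have mU := @measurable_borel_open (X * Y)%type _ oU.
  rewrite m1E// m2E// L1E// L2E//; apply/eqP; rewrite eq_le; apply/andP; split.
    exact: (tonelli_open_le hX hY muI muF nuI nuF oU (oP n) (oQ n) (Poo n) (Qoo n) Un).
  have oU' : open [set z : Y * X | U (z.2, z.1)].
    by apply: open_comp oU => z _; exact: continuous_swap.
  apply: (tonelli_open_le hY hX nuI nuF muI muF oU' (oQ n) (oP n) (Qoo n) (Poo n)).
  by move=> [y x] /= /Un[].
apply: (@measure_unique _ R (borel (X * Y)%type) G (fun n => P n `*` Q n)) => //.
- apply/seteqP; split; last first.
    apply: smallest_sub; first exact: sigma_algebra_measurable.
    by move=> U [oU _]; exact: (@measurable_borel_open (X * Y)%type).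
  apply: smallest_sub; first exact: smallest_sigma_algebra.
  move=> U oU; rewrite (_ : U = \bigcup_n (U `&` (P n `*` Q n))); last first.
    by rewrite -setI_bigcupr PQT setIT.
  apply: sigma_algebra_bigcup => n; apply: sub_gen_smallest.
  by split; [exact: openI|exists n => z []].
- move=> U V [oU [n Un]] [oV _]; split; first exact: openI.
  by exists n => z [/Un].
- by move=> n; split=> //; exists n.
- move=> n; rewrite m1E; last exact: (@measurable_borel_open (X * Y)%type).
  rewrite L1E; last exact: (@measurable_borel_open (X * Y)%type).
  rewrite (eq_integral (fun x : borel X => nu (Q n) * (\1_(P n) x)%:E)); last first.
    move=> x _; rewrite indicE; have [xP|xP] := boolP (x \in P n).
      rewrite mule1; congr (nu _); apply/seteqP; split=> y; first by case.
      by move: xP; rewrite inE.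
    rewrite mule0 (_ : [set _ | _] = set0)// -subset0 => y [/=].
    by move: xP; rewrite notin_setE.
  have mP : measurable (P n : set (borel X)) by exact: measurable_borel_open.
  rewrite ge0_integralZl//; last by apply/measurable_EFinP.
  rewrite integral_indic// setIT; apply: lte_mul_pinfty => //.
  by rewrite ge0_fin_numE.
Qed.
End Tonelli.

(** * Haar measure on topological groups *)

Section TopGroup.
Context (G : topGroupType).
Implicit Types (L : set G).
Local Open Scope group_scope.

Lemma continuous_mulgl (g : G) : continuous (fun x : G => g * x).
Proof.
move=> x; apply: (@continuous_comp _ _ _ (fun x => (g, x)) (fun z : G * G => z.1 * z.2)).
  exact: continuous_pairr.
exact: mulg_continuous.
Qed.

Lemma mulgl_imageE (g : G) (A : set G) :
  (fun x => g * x) @` A = (fun x => g^-1 * x) @^-1` A.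
Proof.
apply/seteqP; split=> [_ [x Ax <-]|x Ax] /=; first by rewrite mulKg.
by exists (g^-1 * x) => //; rewrite mulVKg.
Qed.

Lemma open_mulgl (g : G) (U : set G) : open U -> open ((fun x => g * x) @` U).
Proof. by move=> oU; rewrite mulgl_imageE; apply: open_comp => // x _; exact: continuous_mulgl. Qed.

Definition sigma_subgroup L :=
  [/\ open L, L 1, forall x y, L x -> L y -> L (x * y), forall x, L x -> L x^-1
    & exists2 E : nat -> set G, forall n, compact (E n) & L = \bigcup_n E n].

(** The complement is a union of left cosets of [L], which are as open as [L]. *)
Lemma open_subgroup_closed L : open L -> L 1 ->
  (forall x y, L x -> L y -> L (x * y)) -> (forall x, L x -> L x^-1) -> closed L.
Proof.
move=> oL L1 LM LV; rewrite -openC openE => x /= Lx.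
have oxL := open_mulgl x oL.
have xL : ((fun y => x * y) @` L) x by exists 1 => //; rewrite mulg1.
apply: filterS (open_nbhs_nbhs (conj oxL xL)) => _ [y Ly <-] Lxy; apply: Lx.
by rewrite -(mulgK y x); apply: LM => //; exact: LV.
Qed.

Lemma sigma_subgroup_closed L : sigma_subgroup L -> closed L.
Proof. by move=> [oL L1 LM LV _]; exact: open_subgroup_closed. Qed.

(** Start from a compact neighbourhood [W] of the identity; at each step adjoin the next compact set
    and form all quotients, which keeps the set compact. The increasing union is closed under
    division, hence a subgroup, and it is open because it contains [W]. *)
Lemma sigma_subgroup_compacts (C : nat -> set G) : lc_hausdorff G ->
  (forall n, compact (C n)) -> exists2 L, sigma_subgroup L & forall n, C n `<=` L.
Proof.
move=> [lcG hG] cC.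
have [W W1 cW] : exists2 W, nbhs (1 : G) W & compact W.
  have [W + [cW _]] := lcG 1 Logic.I; rewrite withinET => W1.
  by exists W.
pose step (A B : set G) := (fun z : G * G => z.1 * z.2^-1) @` ((A `|` B) `*` (A `|` B)).
pose E := fix E n := if n is m.+1 then step (E m) (C m) else W.
have cE n : compact (E n).
  elim: n => [//|n IH] /=; apply: continuous_compact; last first.
    by apply: compact_setX; exact: compactU.
  apply: continuous_subspaceT => z.
  apply: (@continuous_comp _ _ _ (fun z : G * G => (z.1, z.2^-1)) (fun z : G * G => z.1 * z.2)).
    apply: cvg_pair; first exact: cvg_fst.
    by apply: continuous_comp; [exact: cvg_snd|exact: invg_continuous].
  exact: mulg_continuous.
have E1 n : E n 1.
  elim: n => [|n IH] /=; first exact: nbhs_singleton.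
  by exists (1, 1) => /=; [split; left|rewrite mulgV].
have EC n x : E n x \/ C n x -> E n.+1 x.
  by move=> xE; exists (x, 1) => /=; [split=> //; left|rewrite invg1 mulg1].
have EE m n : (m <= n)%N -> E m `<=` E n.
  elim: n => [|n IH]; first by rewrite leqn0 => /eqP ->.
  rewrite leq_eqVlt => /predU1P[->//|]; rewrite ltnS => /IH mn x /mn Enx.
  by apply: EC; left.
pose L := \bigcup_n E n.
have LD x y : L x -> L y -> L (x * y^-1).
  move=> [m _ Emx] [n _ Eny]; exists (maxn m n).+1 => //.
  exists (x, y) => //; split; left.
    exact: EE (leq_maxl _ _) _ Emx.
  exact: EE (leq_maxr _ _) _ Eny.
have L1 : L 1 by exists 0%N.
have LV x : L x -> L x^-1 by move=> Lx; rewrite -(mul1g x^-1); exact: LD.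
have LM x y : L x -> L y -> L (x * y).
  by move=> Lx Ly; rewrite -(invgK y); apply: LD => //; exact: LV.
exists L; last by move=> n x Cx; exists n.+1 => //; apply: EC; right.
split=> //; last by exists E.
rewrite openE => x Lx.
have [U [oU U1] UW] : exists2 U : set G, open_nbhs 1 U & U `<=` W.
  by move: W1; rewrite nbhsE.
apply: filterS (open_nbhs_nbhs (conj (open_mulgl x oU) _)); last first.
  by exists 1 => //; rewrite mulg1.
by move=> _ [y Uy <-]; apply: LM => //; exists 0%N => //; exact: UW.
Qed.

(** What restricting Haar measure requires, freed from the group law: the product of [A] and [B]
    need not be a subgroup of the semidirect product, since [B] need not be invariant under
    [tau]. *)
Definition sigma_clopen L := [/\ open L, closed L
  & exists2 E : nat -> set G, forall n, compact (E n) & L = \bigcup_n E n].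

Lemma sigma_subgroup_clopen L : sigma_subgroup L -> sigma_clopen L.
Proof. by move=> LL; split; [case: LL|exact: sigma_subgroup_closed|case: LL]. Qed.
End TopGroup.

Section Haar.
Context (R : realType) (G : topGroupType).
Variable mu : {measure set (borel G) -> \bar R}.
Hypothesis hG : hausdorff_space G.
Hypothesis haar : left_haar mu.
Local Open Scope ereal_scope.

Lemma haar_inner_open : inner_open mu.
Proof. by case: haar => [[]]. Qed.

(* Otherwise translates of a null open set would cover every compact set, and
   finite unions of them are null. *)
Lemma haar_open_eq0 (U : set G) : open U -> mu U = 0 -> U = set0.
Proof.
move=> oU U0; apply/seteqP; split=> // u Uu; have [_ /eqP mu0 inv] := haar; apply: mu0.
rewrite (haar_inner_open openT); apply/eqP; rewrite eq_le; apply/andP; split; last first.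
  by apply: ereal_sup_ubound; exists set0; [split=> //; exact: compact0|rewrite measure0].
apply: ge_ereal_sup => _ [C [cC _] <-].
pose null (V : set G) := open V /\ mu V = 0.
pose I := {V : set G | null V}.
pose F : set_system I := filter_from setT
  (fun V0 : I => [set V : I | sval V0 `<=` sval V]).
have mop (V : I) : measurable (sval V : set (borel G)).
  by apply: measurable_borel_open; case: (svalP V).
have FF : Filter F.
  apply: filter_from_filter.
    by exists (exist null set0 (conj open0 (measure0 mu))).
  move=> V W _ _; have VW : open (sval V `|` sval W) /\ mu (sval V `|` sval W) = 0.
    split; first by apply: openU; [case: (svalP V)|case: (svalP W)].
    apply/eqP; rewrite -measure_le0.
    have I0 (Z : I) : mu (sval Z) <= 0.
      by have [_ Z0] := svalP Z; rewrite le_eqVlt; apply/orP; left; apply/eqP.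
    by apply: (le_trans (measureU2 _ (mop V) (mop W))); apply: adde_le0; exact: I0.
  exists (exist null _ VW) => // Z /= VWZ; split=> z Hz; apply: VWZ; [left|right] => //.
have /compact_near_coveringP/(_ I F (fun V x => sval V x) FF)[x _|V0 _ /(_ V0)] := cC.
  pose g := (x * u^-1)%g.
  have Vg : open ((fun y => (g * y)%g) @` U) /\ mu ((fun y => (g * y)%g) @` U) = 0.
    split; first exact: open_mulgl.
    by rewrite inv//; exact: measurable_borel_open.
  exists ((fun y => (g * y)%g) @` U, [set V : I | (fun y => (g * y)%g) @` U `<=` sval V]) => /=.
    split; last by exists (exist null _ Vg).
    apply: open_nbhs_nbhs; split; first by case: Vg.
    by exists u => //; rewrite mulgVK.
  by move=> [y V] /= [Uy]; exact.
move=> /(_ (fun _ h => h)) CV.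
have [_ <-] := svalP V0; apply: le_measure => //; rewrite inE.
  exact: measurable_borel_compact.
exact: mop.
Qed.

Lemma haar_compact_open (C : set G) : compact C ->
  exists U : set G, [/\ open U, C `<=` U & mu U < +oo].
Proof.
move=> cC; have [[fin outer _] _ _] := haar.
have mC : measurable (C : set (borel G)).
  exact: measurable_borel_compact.
have := fin C cC; rewrite outer// => /ereal_inf_lt[_ [U [oU CU] <-] Uoo].
by exists U.
Qed.

Section Restriction.
Variables (L : set G) (LL : sigma_clopen L).

Lemma sigma_clopen_measurable : measurable (L : set (borel G)).
Proof. by apply: measurable_borel_open; case: LL. Qed.

Lemma haar_restr_inner : inner_open (mrestr mu sigma_clopen_measurable).
Proof.
move=> U oU; rewrite /mrestr; have [oL _ _] := LL.
have oUL : open (U `&` L) by exact: openI.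
apply/eqP; rewrite eq_le; apply/andP; split.
  rewrite [leLHS](haar_inner_open oUL); apply: ge_ereal_sup => _ [C [cC CUL] <-].
  apply: ereal_sup_ubound; exists C; first by split=> // x /CUL[].
  by congr (mu _); apply/setIidPl => x /CUL[].
apply: ge_ereal_sup => _ [C [cC CU] <-]; apply: le_measure; rewrite ?inE.
- exact: measurable_borel_compact.
- exact: measurable_borel_open.
- exact: CU.
Qed.

(** The compact pieces of [L] have open neighbourhoods of finite measure. The complement of [L] is
    open and null for the restricted measure, so adding it to finite unions of these neighbourhoods
    exhausts the whole group. *)
Lemma haar_restr_sigma_finite : open_sigma_finite (mrestr mu sigma_clopen_measurable).
Proof.
have [oL cL [E cE LE]] := LL.
have /choice[U HU] := fun n => haar_compact_open (cE n).
pose P n := ~` L `|` \bigcup_(i < n.+1) U i.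
exists P; split=> [n|m n mn|//|n].
- apply: openU; first exact: closed_openC.
  by apply: bigcup_open => i _; case: (HU i).
- apply/subsetPset; apply: setUS; apply: bigcup_sub => i /= im; apply: bigcup_sup => /=.
  exact: leq_trans im _.
- rewrite -subTset => x _; have [Lx|Lx] := pselect (L x); last by exists 0%N => //; left.
  move: Lx; rewrite LE => -[n _ Enx]; exists n => //; right; exists n => /=; first exact: ltnSn.
  by have [_ EU _] := HU n; exact: EU.
- suff : mu (P n `&` L) < +oo by [].
  rewrite (_ : P n `&` L = (\big[setU/set0]_(i < n.+1) U i) `&` L); last first.
    by rewrite /P setIUl setICl set0U bigcup_mkord.
  have mU i : measurable (U i : set (borel G)).
    by apply: measurable_borel_open; case: (HU i).
  apply: (@le_lt_trans _ _ (mu (\big[setU/set0]_(i < n.+1) U i))).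
    apply: le_measure => //; rewrite inE; last exact: bigsetU_measurable.
    by apply: measurableI; [exact: bigsetU_measurable|exact: sigma_clopen_measurable].
  apply: (@le_lt_trans _ _ (\sum_(i < n.+1) mu (U i))).
    exact: Boole_inequality.
  by apply/lte_sum_pinfty => i _; case: (HU i).
Qed.
End Restriction.
End Haar.

Lemma hausdorff_prod (S T : topologicalType) :
  hausdorff_space S -> hausdorff_space T -> hausdorff_space (S * T)%type.
Proof.
move=> hS hT [p1 p2] [q1 q2] clpq; congr pair.
- apply: hS => A B pA qB.
  have [] := clpq (fst @^-1` A) (fst @^-1` B); [exact: (cvg_fst pA)|exact: (cvg_fst qB)|].
  by move=> [a b] [/= Aa Ba]; exists a.
- apply: hT => A B pA qB.
  have [] := clpq (snd @^-1` A) (snd @^-1` B); [exact: (cvg_snd pA)|exact: (cvg_snd qB)|].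
  by move=> [a b] [/= Aa Ba]; exists b.
Qed.

(** * Supports of integrable functions *)

Section Support.
Context (R : realType) (G : topGroupType).
Variable mu : {measure set (borel G) -> \bar R}.
Hypothesis hG : hausdorff_space G.
Hypothesis haar : left_haar mu.
Local Open Scope ereal_scope.

(* The set lies in an open [U] of finite measure, which is exhausted up to a
   null set by countably many compact sets; what a closed set containing these
   leaves out of [U] is open and null, hence empty. *)
Lemma haar_finite_support (A : set (borel G)) : measurable A -> mu A < +oo ->
  exists2 C : nat -> set G, forall n, compact (C n) &
    forall D : set G, closed D -> (forall n, C n `<=` D) -> A `<=` D.
Proof.
move=> mA Aoo; have [[_ outer _] _ _] := haar.
move: Aoo; rewrite outer// => /ereal_inf_lt[_ [U [oU AU] <-] Uoo].
have fU : mu U \is a fin_num by rewrite ge0_fin_numE.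
have /choice[C HC] : forall n, exists C : set G,
    [/\ compact C, C `<=` U & mu U <= mu C + (n.+1%:R^-1)%:E].
  move=> n; have : mu U - (n.+1%:R^-1)%:E < mu U.
    by rewrite lteBlDr// lteDl// lte_fin invr_gt0 ltr0n.
  rewrite {2}(haar_inner_open haar oU) => /ereal_sup_gt[_ [C [cC CU] <-]] CC.
  by exists C; split=> //; rewrite -leeBlDr// ltW.
exists C => [n|D cD CD x /AU Ux]; first by case: (HC n).
apply: contrapT => Dx.
have oUD : open (U `&` ~` D) by apply: openI => //; exact: closed_openC.
have : (U `&` ~` D) x by [].
rewrite (haar_open_eq0 hG haar oUD)//; apply/eqP; rewrite -measure_le0.
apply/lee_addgt0Pr => e e0; rewrite add0e.
pose n := Num.truncn e^-1.
have [cC CU UC] := HC n.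
have mC : measurable (C n : set (borel G)) by exact: measurable_borel_compact.
have mU : measurable (U : set (borel G)) by exact: measurable_borel_open.
have fC : mu (C n) \is a fin_num.
  by rewrite ge0_fin_numE//; apply: le_lt_trans Uoo; apply: le_measure; rewrite ?inE.
apply: (@le_trans _ _ (mu (U `\` C n))).
  apply: le_measure; rewrite ?inE; [exact: measurable_borel_open|exact: measurableD|].
  by move=> y [Uy Dy]; split=> // /CD.
rewrite measureD// (setIidr CU) leeBlDl//; apply: (le_trans UC).
rewrite leeD2l// lee_fin invf_ple ?posrE//.
by rewrite ltW// truncnS_gt.
Qed.

(** The set where [f] is nonzero is the union of the sets [1 / (n + 1) <= |f|], which have finite
    measure by Markov's inequality. The compact sets attached to each of them are merged into one
    sequence by [pickle]. *)
Lemma L1fun_support (f : L1fun mu) :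
  exists2 C : nat -> set G, forall n, compact (C n) &
    forall D : set G, closed D -> (forall n, C n `<=` D) ->
      forall x, ~ D x -> f x = 0%R.
Proof.
pose A n : set (borel G) := [set x | (n.+1%:R^-1 <= normc (f x))%R].
have mf := @measurable_normc _ _ _ mu f.
have mA n : measurable (A n).
  rewrite (_ : A n = [set: borel G] `&` (fun x => normc (f x)) @^-1` [set r | (n.+1%:R^-1 <= r)%R]).
    by apply: mf => //; rewrite -set_itvcy; exact: measurable_itv.
  by rewrite setTI.
have Aoo n : mu (A n) < +oo.
  have : (n.+1%:R^-1)%:E * mu (A n) < +oo.
    apply: (@le_lt_trans _ _ (\int[mu]_x (normc (f x))%:E)).
      have -> : mu (A n) = \int[mu]_x (\1_(A n) x)%:E by rewrite integral_indic// setIT.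
      rewrite -ge0_integralZl_EFin//; last by apply/measurable_EFinP.
      apply: ge0_le_integral => //.
      - by apply: measurable_funeM; exact/measurable_EFinP.
      - exact/measurable_EFinP.
      - move=> x _; rewrite -EFinM lee_fin indicE.
        have [/set_mem|_] := boolP (x \in A n); first by rewrite mulr1.
        by rewrite mulr0 normc_ge0.
    have := integrable_normc f; move/integrableP => [_]; congr (_ < _).
    by apply: eq_integral => x _; rewrite gee0_abs// lee_fin normc_ge0.
  case: (mu (A n)) => // [r _|]; first exact: ltry.
  by rewrite gt0_muley// lte_fin invr_gt0 ltr0n.
have /choice[C HC] : forall n, exists C : nat -> set G, (forall m, compact (C m)) /\
    forall D : set G, closed D -> (forall m, C m `<=` D) -> A n `<=` D.
  by move=> n; have [C cC CD] := haar_finite_support (mA n) (Aoo n); exists C.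
exists (fun k => if unpickle k is Some (n, m) then C n m else set0) => [k|D cD CD x Dx].
  by case: (unpickle k) => [[n m]|]; [have [] := HC n|exact: compact0].
apply: contrapT => fx0; apply: Dx.
have fx : (0 < normc (f x))%R.
  by rewrite lt_neqAle normc_ge0 andbT eq_sym; apply/eqP => /eq0_normc.
have [_ /(_ D cD)] := HC (Num.truncn (normc (f x))^-1).
apply.
  by move=> m; have := CD (pickle (Num.truncn (normc (f x))^-1, m)); rewrite pickleK.
rewrite /A/= invf_ple ?posrE//; exact/ltW/truncnS_gt.
Qed.
End Support.

(** * Haar integrals of functions with sigma-compact support *)

Section SupportedSections.
Context (R : realType) (X : ptopologicalType) (K : topGroupType).
Variable nu : {measure set (borel K) -> \bar R}.
Hypothesis hK : hausdorff_space K.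
Hypothesis haarK : left_haar nu.
Variable B : set K.
Hypothesis BB : sigma_clopen B.
Local Open Scope ereal_scope.

Let rI := haar_restr_inner hK haarK BB.
Let rF := haar_restr_sigma_finite hK haarK BB.

(** As [F] vanishes off [B], its integrals do not change when [nu] is restricted to [B], and the
    restricted measure is sigma-finite. *)
Lemma ge0_mfun_integral_supp (F : X * K -> \bar R) :
  ge0_mfun (F : borel (X * K)%type -> \bar R) ->
  (forall x y, ~ B y -> F (x, y) = 0) ->
  ge0_mfun (fun x : borel X => \int[nu]_y F (x, y)).
Proof.
move=> mF FB; split; last by move=> x; apply: integral_ge0 => y _; exact: mF.2.
have := ge0_measurable_integral_section hK rI rF mF.
rewrite (_ : (fun x => _) = fun x : borel X => \int[nu]_y F (x, y))//.
apply/funext => x; apply: ge0_integral_mrestr_support; last exact: FB.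
split=> [|y]; last exact: mF.2.
exact: measurable_fun_sectionr mF.1.
Qed.

Lemma measurable_integral_supp (F : X * K -> \bar R) :
  measurable_fun setT (F : borel (X * K)%type -> \bar R) ->
  (forall x y, ~ B y -> F (x, y) = 0) ->
  measurable_fun setT (fun x : borel X => \int[nu]_y F (x, y)).
Proof.
move=> mF FB.
have mp : ge0_mfun (fun z : borel (X * K)%type => F^\+ z).
  by split=> //; exact: measurable_funepos.
have mn : ge0_mfun (fun z : borel (X * K)%type => F^\- z).
  by split=> //; exact: measurable_funeneg.
have [mIp _] : ge0_mfun (fun x : borel X => \int[nu]_y F^\+ (x, y)).
  by apply: ge0_mfun_integral_supp => // x y By; rewrite funeposE FB// maxxx.
have [mIn _] : ge0_mfun (fun x : borel X => \int[nu]_y F^\- (x, y)).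
  by apply: ge0_mfun_integral_supp => // x y By; rewrite funenegE FB// oppe0 maxxx.
rewrite (_ : (fun _ => _) =
    fun x : borel X => \int[nu]_y F^\+ (x, y) - \int[nu]_y F^\- (x, y)).
  exact: emeasurable_funB.
apply/funext => x; rewrite integralE; congr (_ - _).
  by apply: eq_integral => y _; rewrite !funeposE.
by apply: eq_integral => y _; rewrite !funenegE.
Qed.

Lemma haar_integral_mulgl (f : borel K -> \bar R) (s : K) : ge0_mfun f ->
  \int[nu]_k f (s^-1 * k)%g = \int[nu]_k f k.
Proof.
move=> [mf f0].
have mphi := continuous_borel_measurable (@continuous_mulgl K (s^-1)%g).
have := @ge0_integral_pushforward _ _ (borel K) (borel K) R _ mphi nu setT f
  measurableT mf (fun y _ => f0 y).
rewrite preimage_setT => <-.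
apply: eq_measure_integral => A mA _; have [_ _ inv] := haarK.
by rewrite -(inv s A mA) mulgl_imageE.
Qed.
End SupportedSections.

Section SupportedTonelli.
Context (R : realType) (H K : topGroupType).
Variables (muH : {measure set (borel H) -> \bar R}) (muK : {measure set (borel K) -> \bar R}).
Hypotheses (hH : hausdorff_space H) (hK : hausdorff_space K).
Hypotheses (haarH : left_haar muH) (haarK : left_haar muK).
Variables (A : set H) (B : set K).
Hypotheses (AA : sigma_clopen A) (BB : sigma_clopen B).
Local Open Scope ereal_scope.

Let rH := mrestr muH (sigma_clopen_measurable AA).
Let rK := mrestr muK (sigma_clopen_measurable BB).

Lemma ge0_mfun_sectionr (X Y : ptopologicalType) (f : X * Y -> \bar R) (x : X) :
  ge0_mfun (f : borel (X * Y)%type -> \bar R) -> ge0_mfun (fun y : borel Y => f (x, y)).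
Proof. by move=> [mf f0]; split=> //; exact: measurable_fun_sectionr mf. Qed.

Lemma ge0_mfun_sectionl (X Y : ptopologicalType) (f : X * Y -> \bar R) (y : Y) :
  ge0_mfun (f : borel (X * Y)%type -> \bar R) -> ge0_mfun (fun x : borel X => f (x, y)).
Proof.
apply: (@ge0_mfun_continuous R X (X * Y)%type (fun x => (x, y))).
exact: continuous_pairl.
Qed.

Lemma ge0_mfun_swap (X Y : ptopologicalType) (f : X * Y -> \bar R) :
  ge0_mfun (f : borel (X * Y)%type -> \bar R) ->
  ge0_mfun (fun z : borel (Y * X)%type => f (z.2, z.1)).
Proof.
apply: (@ge0_mfun_continuous R (Y * X)%type (X * Y)%type (fun z => (z.2, z.1))).
exact: continuous_swap.
Qed.

(** Vanishing off [A] and off [B] allows both measures to be restricted, inside and outside, to sets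
    where they are sigma-finite. *)
Lemma ge0_tonelli_supp (F : H * K -> \bar R) :
  ge0_mfun (F : borel (H * K)%type -> \bar R) ->
  (forall h k, ~ A h -> F (h, k) = 0) -> (forall h k, ~ B k -> F (h, k) = 0) ->
  \int[muH]_h \int[muK]_k F (h, k) = \int[muK]_k \int[muH]_h F (h, k).
Proof.
move=> mF FA FB.
have mI1 := ge0_mfun_integral_supp hK haarK BB mF FB.
have mF' := ge0_mfun_swap mF.
have mI2 : ge0_mfun (fun k : borel K => \int[muH]_h F (h, k)).
  by apply: (ge0_mfun_integral_supp hH haarH AA mF') => k h /FA ->.
transitivity (\int[rH]_h \int[rK]_k F (h, k)).
  rewrite [RHS](eq_integral (fun h : borel H => \int[muK]_k F (h, k))); last first.
    move=> h _; apply: ge0_integral_mrestr_support; last exact: FB.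
    exact: ge0_mfun_sectionr.
  apply/esym/ge0_integral_mrestr_support => // h Ah.
  by apply: integral0_eq => k _; exact: FA.
transitivity (\int[rK]_k \int[rH]_h F (h, k)).
  apply: ge0_tonelli => //.
  - exact: haar_restr_inner.
  - exact: haar_restr_sigma_finite.
  - exact: haar_restr_inner.
  - exact: haar_restr_sigma_finite.
rewrite (eq_integral (fun k : borel K => \int[muH]_h F (h, k))); last first.
  move=> k _; apply: ge0_integral_mrestr_support; last by move=> h /FA.
  exact: ge0_mfun_sectionl.
apply: ge0_integral_mrestr_support => // k Bk.
by apply: integral0_eq => h _; exact: FB.
Qed.
End SupportedTonelli.

(** * The Haar measure of a semidirect product *)

Section SemidirectIntegral.
Context (R : realType) (H K : topGroupType) (tau : autHom H K).
Variables (muH : {measure set (borel H) -> \bar R}) (muK : {measure set (borel K) -> \bar R}).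
Hypotheses (hH : hausdorff_space H) (hK : hausdorff_space K).
Hypotheses (haarH : left_haar muH) (haarK : left_haar muK).
Variable delta : H -> R.
Hypothesis mdelta : measurable_fun setT (delta : borel H -> R).
Hypothesis delta_gt0 : forall h, 0 < delta h.
Variable mu : {measure set (borel (semidirect tau)) -> \bar R}.
Hypothesis hmu : is_semidirect_haar muH muK delta mu.
Local Open Scope ereal_scope.

Lemma semidirect_hausdorff : hausdorff_space (semidirect tau).
Proof. exact: (hausdorff_prod hH hK). Qed.

Lemma sigma_clopen_prod (A : set H) (B : set K) :
  sigma_clopen A -> sigma_clopen B -> sigma_clopen (A `*` B : set (semidirect tau)).
Proof.
move=> [oA cA [EA cEA AE]] [oB cB [EB cEB BE]]; split.
- exact: open_setX.
- apply: (@closedI _ (fst @^-1` A) (snd @^-1` B)).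
    by apply: closed_comp => // z _; exact: cvg_fst.
  by apply: closed_comp => // z _; exact: cvg_snd.
- exists (fun n => if unpickle n is Some (i, j) then EA i `*` EB j else set0).
    move=> n; case: (unpickle n) => [[i j]|]; last exact: compact0.
    exact: compact_setX.
  rewrite AE BE; apply/seteqP; split=> [[h k] [[i _ /= hi] [j _ /= kj]]|[h k] [n _]].
    by exists (pickle (i, j)) => //; rewrite pickleK.
  by case: (unpickle n) => [[i j] [/= hi kj]|//]; split; [exists i|exists j].
Qed.

Variables (A : set H) (B : set K).
Hypotheses (AA : sigma_clopen A) (BB : sigma_clopen B).

Let rH := mrestr muH (sigma_clopen_measurable AA).
Let rK := mrestr muK (sigma_clopen_measurable BB).

Let delta0 h : (0 <= delta h)%R. Proof. exact: ltW. Qed.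

Let mdeltaE : ge0_mfun (fun h : borel H => (delta h)%:E).
Proof. by split=> [|h]; [exact/measurable_EFinP|rewrite lee_fin]. Qed.

Let iterated_restr (F : borel (H * K)%type -> \bar R) : ge0_mfun F ->
  \int[rH]_h (\int[rK]_k F (h, k) * (delta h)%:E) =
  \int[muH]_(h in A) (\int[muK]_(k in B) F (h, k) * (delta h)%:E).
Proof.
move=> mF; rewrite ge0_integral_mrestr.
  apply: eq_integral => h _; congr (_ * _); apply: ge0_integral_mrestr.
  exact: ge0_mfun_sectionr.
apply: ge0_mfunM => //; split.
  apply: (ge0_measurable_integral_section hK _ _ mF).
    exact: haar_restr_inner.
  exact: haar_restr_sigma_finite.
by move=> h; apply: integral_ge0 => k _; exact: mF.2.
Qed.

(** The formula in [is_semidirect_haar] concerns open sets. Over the product of [A] and [B] the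
    restricted Haar measure has an exhaustion by open sets of finite measure, so agreement on open
    sets propagates to all Borel sets, and from indicators to functions. *)
Lemma ge0_semidirect_integral (F : borel (semidirect tau) -> \bar R) :
  ge0_mfun F -> (forall h k, ~ A h -> F (h, k) = 0) ->
  (forall h k, ~ B k -> F (h, k) = 0) ->
  \int[mu]_x F x = \int[muH]_h (\int[muK]_k F (h, k) * (delta h)%:E).
Proof.
move=> mF FA FB; have [haar muU] := hmu.
have hG := semidirect_hausdorff.
have AB := sigma_clopen_prod AA BB.
rewrite -(ge0_integral_mrestr_support mu (sigma_clopen_measurable AB) mF); last first.
  move=> [h k] hk; have [Ah|Ah] := pselect (A h); last exact: FA.
  by apply: FB => Bk; apply: hk.
set m := mrestr mu _.
pose L (F : borel (H * K)%type -> \bar R) := \int[rH]_h (\int[rK]_k F (h, k) * (delta h)%:E).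
have LL : integral_like L.
  apply: integral_like_iterated => //.
    exact: haar_restr_inner.
  exact: haar_restr_sigma_finite.
have L0 f : ge0_mfun f -> 0 <= L f.
  move=> [_ f0]; apply: integral_ge0 => x _; apply: mule_ge0; last by rewrite lee_fin.
  exact: integral_ge0.
transitivity (L F); last first.
  rewrite /L iterated_restr//.
  rewrite integral_mkcond; apply: eq_integral => h _.
  rewrite patchE; case: ifPn => [_|]; last first.
    rewrite notin_setE => Ah; rewrite integral0_eq ?mul0e// => k _; exact: FA.
  congr (_ * _); rewrite integral_mkcond; apply: eq_integral => k _.
  by rewrite patchE; case: ifPn => //; rewrite notin_setE => /FB ->.
have [m2 m2E] := integral_like_measure LL L0.
apply: (integral_like_eq (integral_like_integral m) LL) => // E mE.
rewrite integral_indic// setIT -m2E//.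
have [P [oP ndP PT Poo]] := haar_restr_sigma_finite hG haar AB.
apply: (@measure_unique _ R (borel (semidirect tau)) open P) => //.
  by move=> U V; exact: openI.
move=> U oU; rewrite m2E; last exact: measurable_borel_open.
transitivity (mu (U `&` (A `*` B))); first by [].
rewrite muU; last by apply: openI => //; have [] := AB.
rewrite [RHS](@iterated_restr (fun z : borel (H * K)%type => (\1_U z)%:E)); last first.
  by apply: ge0_mfun_indic; exact: measurable_borel_open.
rewrite [RHS]integral_mkcond; apply: eq_integral => h _.
rewrite patchE; case: ifPn => [|]; rewrite (inE, notin_setE) => Ah.
  congr (_ * _); rewrite (_ : [set k | _] = [set k | U (h, k)] `&` B); last first.
    by apply/seteqP; split=> [k [Uk [_ Bk]]|k [Uk Bk]].
  rewrite -[LHS]integral_indic//.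
    exact: sigma_clopen_measurable.
  by apply: measurable_borel_open; exact: open_sectionr.
rewrite (_ : [set k | _] = set0) ?measure0 ?mul0e//.
by rewrite -subset0 => k [_ []].
Qed.
End SemidirectIntegral.

(** * Convolution of nonnegative functions *)

Section Continuity.
Context (S : topologicalType).

Lemma continuous_pair (T U : topologicalType) (u : S -> T) (v : S -> U) :
  continuous u -> continuous v -> continuous (fun x => (u x, v x)).
Proof. by move=> cu cv x; apply: cvg_pair; [exact: cu|exact: cv]. Qed.

Lemma continuous_fst_comp (T U : topologicalType) (u : S -> T * U) :
  continuous u -> continuous (fun x => (u x).1).
Proof. by move=> cu x; apply: (cvg_comp u fst (cu x)); exact: cvg_fst. Qed.

Lemma continuous_snd_comp (T U : topologicalType) (u : S -> T * U) :
  continuous u -> continuous (fun x => (u x).2).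
Proof. by move=> cu x; apply: (cvg_comp u snd (cu x)); exact: cvg_snd. Qed.

Lemma continuous_divl (G : topGroupType) (u v : S -> G) :
  continuous u -> continuous v -> continuous (fun x => ((u x)^-1 * v x)%g).
Proof.
move=> cu cv x; apply: (@continuous_comp _ _ _ (fun x => ((u x)^-1%g, v x))
  (fun z : G * G => (z.1 * z.2)%g)); last exact: mulg_continuous.
apply: cvg_pair; last exact: cv.
by apply: continuous_comp; [exact: cu|exact: invg_continuous].
Qed.

End Continuity.

Ltac solve_cont := repeat first
  [ by move=> ?; exact: cvg_cst | by move=> ?; exact: cvg_id
  | by move=> ?; exact: cvg_fst | by move=> ?; exact: cvg_snd
  | apply: continuous_pair | apply: continuous_divl
  | apply: continuous_fst_comp | apply: continuous_snd_comp ].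

Section Convolution.
Context (R : realType) (H K : topGroupType) (tau : autHom H K).
Variables (muH : {measure set (borel H) -> \bar R}) (muK : {measure set (borel K) -> \bar R}).
Hypotheses (hH : hausdorff_space H) (hK : hausdorff_space K).
Hypotheses (haarH : left_haar muH) (haarK : left_haar muK).
Variable delta : H -> R.
Hypothesis mdelta : measurable_fun setT (delta : borel H -> R).
Hypothesis delta_gt0 : forall h, 0 < delta h.
Variable mu : {measure set (borel (semidirect tau)) -> \bar R}.
Hypothesis hmu : is_semidirect_haar muH muK delta mu.
Variables (A : set H) (B : set K).
Hypotheses (sA : sigma_subgroup A) (sB : sigma_subgroup B).
Local Open Scope ereal_scope.

Let AA := sigma_subgroup_clopen sA.
Let BB := sigma_subgroup_clopen sB.

Let mdeltaE : ge0_mfun (fun h : borel H => (delta h)%:E).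
Proof. by split=> [|h]; [exact/measurable_EFinP|rewrite lee_fin ltW]. Qed.

Definition supported (F : H * K -> \bar R) :=
  (forall h k, ~ A h -> F (h, k) = 0) /\ (forall h k, ~ B k -> F (h, k) = 0).

Definition nonneg_supp (F : H * K -> \bar R) :=
  ge0_mfun (F : borel (H * K)%type -> \bar R) /\ supported F.

Definition nonneg_suppK (P : K -> \bar R) :=
  ge0_mfun (P : borel K -> \bar R) /\ forall k, ~ B k -> P k = 0.

(** The operator [P] of the overview. The weight [delta] makes it preserve total integrals
    ([integral_proj]). *)
Definition proj (F : H * K -> \bar R) (s : K) := \int[muH]_t (F (t, s) * (delta t)%:E).

Definition convK (P : K -> \bar R) (F : H * K -> \bar R) (x : H * K) :=
  \int[muK]_s (P s * F (x.1, (s^-1 * x.2)%g)).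

Definition conv (F G : H * K -> \bar R) (x : H * K) :=
  \int[muH]_t (\int[muK]_s (F (t, s) * G (x.1, (s^-1 * x.2)%g)) * (delta t)%:E).

(** Keeps convolutions supported: if [k] is outside [B] and [s] inside, then [s^-1 k] is outside, so
    one of the two factors vanishes. *)
Lemma subgroup_divlP s k : B s -> B (s^-1 * k)%g -> B k.
Proof. by have [_ _ BM _ _] := sB => Bs /(BM _ _ Bs); rewrite mulVKg. Qed.

Lemma proj_nonneg F : nonneg_supp F -> nonneg_suppK (proj F).
Proof.
move=> [mF [FA FB]]; split; last first.
  by move=> k Bk; apply: integral0_eq => t _; rewrite FB// mul0e.
apply: (@ge0_mfun_integral_supp R K H muH hH haarH A AA (fun z => F (z.2, z.1) * (delta z.2)%:E)).
  apply: ge0_mfunM; first exact: ge0_mfun_swap.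
  apply: (@ge0_mfun_continuous R (K * H)%type H snd _ _ mdeltaE).
  by move=> z; exact: cvg_snd.
by move=> k h Ah; rewrite FA// mul0e.
Qed.

Lemma convK_nonneg P F : nonneg_suppK P -> nonneg_supp F -> nonneg_supp (convK P F).
Proof.
move=> [mP PB] [mF [FA FB]]; split; last split.
- apply: (@ge0_mfun_integral_supp R (H * K)%type K muK hK haarK B BB
    (fun z => P z.2 * F (z.1.1, (z.2^-1 * z.1.2)%g))); last first.
    by move=> x s Bs; rewrite PB// mul0e.
  apply: ge0_mfunM.
    apply: (@ge0_mfun_continuous R (H * K * K)%type K snd _ _ mP).
    by move=> z; exact: cvg_snd.
  apply: (@ge0_mfun_continuous R (H * K * K)%type (H * K)%type
    (fun z => (z.1.1, (z.2^-1 * z.1.2)%g)) _ _ mF).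
  by solve_cont.
- by move=> h k Ah; apply: integral0_eq => s _; rewrite FA// mule0.
- move=> h k Bk; apply: integral0_eq => s _.
  have [Bs|Bs] := pselect (B s); last by rewrite PB// mul0e.
  by rewrite FB ?mule0//= => /(subgroup_divlP Bs).
Qed.

(** The factor [G (h, s^-1 k)] does not involve [t], so after exchanging the integrals the weighted
    integral over [t] acts on [F] alone. *)
Lemma convE F G : nonneg_supp F -> nonneg_supp G -> conv F G = convK (proj F) G.
Proof.
move=> [mF [FA FB]] [mG [GA GB]]; apply/funext => -[h k]; rewrite /conv /convK/=.
have mGs : ge0_mfun (fun s : borel K => G (h, (s^-1 * k)%g)).
  apply: (@ge0_mfun_continuous R K (H * K)%type (fun s => (h, (s^-1 * k)%g)) _ _ mG).
  by solve_cont.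
pose Phi (z : H * K) := F z * G (h, (z.2^-1 * k)%g) * (delta z.1)%:E.
have mPhi : ge0_mfun (Phi : borel (H * K)%type -> \bar R).
  apply: ge0_mfunM; first apply: ge0_mfunM => //.
    apply: (@ge0_mfun_continuous R (H * K)%type K snd _ _ mGs).
    by move=> z; exact: cvg_snd.
  apply: (@ge0_mfun_continuous R (H * K)%type H fst _ _ mdeltaE).
  by move=> z; exact: cvg_fst.
transitivity (\int[muH]_t \int[muK]_s Phi (t, s)).
  apply: eq_integral => t _; rewrite -ge0_integralZr//; last by rewrite lee_fin ltW.
    by apply: (emeasurable_funM _ mGs.1); exact: measurable_fun_sectionr mF.1.
  by move=> s _; rewrite mule_ge0//; [exact: mF.2|exact: mG.2].
rewrite (ge0_tonelli_supp hH hK haarH haarK AA BB mPhi); last 2 first.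
- by move=> t s At; rewrite /Phi FA// !mul0e.
- by move=> t s Bs; rewrite /Phi FB// !mul0e.
apply: eq_integral => s _; rewrite -ge0_integralZr//.
- by apply: eq_integral => t _; rewrite /Phi/= muleAC.
- by apply: (emeasurable_funM _ mdeltaE.1); have [] := ge0_mfun_sectionl s mF.
- by move=> t _; rewrite mule_ge0//; [exact: mF.2|rewrite lee_fin ltW].
- exact: mGs.2.
Qed.

Lemma conv_nonneg F G : nonneg_supp F -> nonneg_supp G -> nonneg_supp (conv F G).
Proof. by move=> mF mG; rewrite convE//; apply: convK_nonneg => //; exact: proj_nonneg. Qed.

(** Convolving with [P] moves only the [K] variable, so the weighted integral over [H] passes inside
    by Tonelli's theorem. *)
Lemma proj_convK P F k : nonneg_suppK P -> nonneg_supp F ->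
  proj (convK P F) k = \int[muK]_s (P s * proj F (s^-1 * k)%g).
Proof.
move=> [mP PB] [mF [FA FB]]; rewrite /proj /convK/=.
pose Phi (z : H * K) := P z.2 * F (z.1, (z.2^-1 * k)%g) * (delta z.1)%:E.
have mFk : ge0_mfun (fun z : borel (H * K)%type => F (z.1, (z.2^-1 * k)%g)).
  apply: (@ge0_mfun_continuous R (H * K)%type (H * K)%type
    (fun z => (z.1, (z.2^-1 * k)%g)) _ _ mF).
  by solve_cont.
have mP2 : ge0_mfun (fun z : borel (H * K)%type => P z.2).
  apply: (@ge0_mfun_continuous R (H * K)%type K snd _ _ mP).
  by move=> z; exact: cvg_snd.
have mPhi : ge0_mfun (Phi : borel (H * K)%type -> \bar R).
  apply: ge0_mfunM; first exact: ge0_mfunM.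
  apply: (@ge0_mfun_continuous R (H * K)%type H fst _ _ mdeltaE).
  by move=> z; exact: cvg_fst.
transitivity (\int[muH]_t \int[muK]_s Phi (t, s)).
  apply: eq_integral => t _; rewrite -ge0_integralZr//; last by rewrite lee_fin ltW.
    by have [] := ge0_mfun_sectionr t (ge0_mfunM mP2 mFk).
  by move=> s _; rewrite mule_ge0//; [exact: mP.2|exact: mF.2].
rewrite (ge0_tonelli_supp hH hK haarH haarK AA BB mPhi); last 2 first.
- by move=> t s At; rewrite /Phi FA// mule0 mul0e.
- by move=> t s Bs; rewrite /Phi PB// !mul0e.
apply: eq_integral => s _; rewrite -ge0_integralZl//.
- by apply: eq_integral => t _; rewrite /Phi/= muleA.
- by apply: (emeasurable_funM _ mdeltaE.1); have [] := ge0_mfun_sectionl s mFk.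
- by move=> t _; rewrite mule_ge0//; [exact: mF.2|rewrite lee_fin ltW].
- exact: mP.2.
Qed.

Lemma convKA P Q F : nonneg_suppK P -> nonneg_suppK Q -> nonneg_supp F ->
  convK P (convK Q F) = convK (fun k => \int[muK]_s (P s * Q (s^-1 * k)%g)) F.
Proof.
move=> [mP PB] [mQ QB] [mF [FA FB]]; apply/funext => -[h k]; rewrite /convK/=.
pose Phi (z : K * K) := P z.2 * Q (z.2^-1 * z.1)%g * F (h, (z.1^-1 * k)%g).
have mFk : ge0_mfun (fun u : borel K => F (h, (u^-1 * k)%g)).
  apply: (@ge0_mfun_continuous R K (H * K)%type (fun s => (h, (s^-1 * k)%g)) _ _ mF).
  by solve_cont.
have mPQ : ge0_mfun (fun z : borel (K * K)%type => P z.2 * Q (z.2^-1 * z.1)%g).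
  apply: ge0_mfunM.
    by apply: (@ge0_mfun_continuous R (K * K)%type K snd _ _ mP) => z; exact: cvg_snd.
  apply: (@ge0_mfun_continuous R (K * K)%type K (fun z => z.2^-1 * z.1)%g _ _ mQ).
  by solve_cont.
have mPhi : ge0_mfun (Phi : borel (K * K)%type -> \bar R).
  apply: ge0_mfunM => //.
  by apply: (@ge0_mfun_continuous R (K * K)%type K fst _ _ mFk) => z; exact: cvg_fst.
transitivity (\int[muK]_u \int[muK]_s Phi (u, s)); last first.
  apply: eq_integral => u _; rewrite -ge0_integralZr//.
  - by have [] := ge0_mfun_sectionr u mPQ.
  - by move=> s _; rewrite mule_ge0//; [exact: mP.2|exact: mQ.2].
  - exact: mFk.2.
rewrite (ge0_tonelli_supp hK hK haarK haarK BB BB mPhi); last 2 first.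
- move=> u s Bu; rewrite /Phi/=.
  have [Bs|Bs] := pselect (B s); last by rewrite PB// !mul0e.
  by rewrite QB ?mule0 ?mul0e// => /(subgroup_divlP Bs).
- by move=> u s Bs; rewrite /Phi/= PB// !mul0e.
apply: eq_integral => s _.
(* Substituting [u = s r], which preserves [dk], turns [Q (s^-1 u) F (h, u^-1 k)] into [f r]. *)
pose f (r : borel K) := Q r * F (h, (r^-1 * (s^-1 * k))%g).
have mf : ge0_mfun f.
  apply: ge0_mfunM => //.
  apply: (@ge0_mfun_continuous R K (H * K)%type (fun r => (h, (r^-1 * (s^-1 * k))%g)) _ _ mF).
  by solve_cont.
rewrite -(haar_integral_mulgl haarK s mf) -ge0_integralZl//.
- by apply: eq_integral => u _; rewrite /Phi/f/= muleA invgM invgK -!mulgA mulVKg.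
- apply: (@ge0_mfun_continuous R K K (fun u => s^-1 * u)%g f _ mf).1.
  exact: continuous_mulgl.
- by move=> u _; exact: mf.2.
- exact: mP.2.
Qed.

(** Both sides are the convolution of [E] by the [K]-convolution of [proj F] and [proj G]: on the
    left by [proj_convK], on the right by [convKA]. *)
Lemma convA F G E : nonneg_supp F -> nonneg_supp G -> nonneg_supp E ->
  conv (conv F G) E = conv F (conv G E).
Proof.
move=> mF mG mE; have [mpF mpG] := (proj_nonneg mF, proj_nonneg mG).
rewrite (convE mF (conv_nonneg mG mE)) (convE mG mE) convKA//.
rewrite (convE (conv_nonneg mF mG) mE) (convE mF mG).
by congr (convK _ E); apply/funext => k; exact: proj_convK.
Qed.

Lemma integral_proj F : nonneg_supp F -> \int[muK]_s proj F s = \int[mu]_x F x.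
Proof.
move=> [mF [FA FB]].
rewrite (ge0_semidirect_integral hH hK haarK mdelta delta_gt0 hmu AA BB mF)//.
pose Phi (z : H * K) := F z * (delta z.1)%:E.
have mPhi : ge0_mfun (Phi : borel (H * K)%type -> \bar R).
  apply: ge0_mfunM => //.
  by apply: (@ge0_mfun_continuous R (H * K)%type H fst _ _ mdeltaE) => z; exact: cvg_fst.
transitivity (\int[muK]_s \int[muH]_t Phi (t, s)); first by [].
rewrite -(ge0_tonelli_supp hH hK haarH haarK AA BB mPhi); last 2 first.
- by move=> t s At; rewrite /Phi FA// mul0e.
- by move=> t s Bs; rewrite /Phi FB// mul0e.
apply: eq_integral => t _; rewrite -ge0_integralZr//.
- by have [] := ge0_mfun_sectionr t mF.
- by move=> s _; exact: mF.2.
- by rewrite lee_fin ltW.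
Qed.

(** For fixed [h], Tonelli's theorem and left invariance split the integral over [k] into the
    integral of [proj F] times that of [G (h, k)]. Integrating against [delta h dh] then gives the
    product. *)
Lemma integral_conv F G : nonneg_supp F -> nonneg_supp G ->
  \int[mu]_x conv F G x = \int[mu]_x F x * \int[mu]_x G x.
Proof.
move=> mF mG; rewrite convE//.
have [mP PB] := proj_nonneg mF; have [mPG [PGA PGB]] := convK_nonneg (proj_nonneg mF) mG.
rewrite -(integral_proj mF).
move: mG => [mG [GA GB]].
rewrite (ge0_semidirect_integral hH hK haarK mdelta delta_gt0 hmu AA BB mPG)//.
rewrite (ge0_semidirect_integral hH hK haarK mdelta delta_gt0 hmu AA BB mG)//.
have mN : ge0_mfun (fun h : borel H => \int[muK]_k G (h, k)).
  exact: (ge0_mfun_integral_supp hK haarK BB mG).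
rewrite -ge0_integralZl//; last 3 first.
- by apply: emeasurable_funM; [exact: mN.1|exact: mdeltaE.1].
- by move=> h _; rewrite mule_ge0//; [exact: mN.2|rewrite lee_fin ltW].
- by apply: integral_ge0 => s _; exact: mP.2.
apply: eq_integral => h _; rewrite muleA; congr (_ * _).
pose Phi (z : K * K) := proj F z.2 * G (h, (z.2^-1 * z.1)%g).
have mPhi : ge0_mfun (Phi : borel (K * K)%type -> \bar R).
  apply: ge0_mfunM.
    by apply: (@ge0_mfun_continuous R (K * K)%type K snd _ _ mP) => z; exact: cvg_snd.
  apply: (@ge0_mfun_continuous R (K * K)%type (H * K)%type (fun z => (h, (z.2^-1 * z.1)%g)) _ _ mG).
  by solve_cont.
transitivity (\int[muK]_k \int[muK]_s Phi (k, s)); first by [].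
rewrite (ge0_tonelli_supp hK hK haarK haarK BB BB mPhi); last 2 first.
- move=> u s Bu; rewrite /Phi/=.
  have [Bs|Bs] := pselect (B s); last by rewrite PB// !mul0e.
  by rewrite GB ?mule0// => /(subgroup_divlP Bs).
- by move=> u s Bs; rewrite /Phi/= PB// !mul0e.
rewrite -ge0_integralZr//; last 3 first.
- exact: mP.1.
- by move=> s _; exact: mP.2.
- exact: mN.2.
apply: eq_integral => s _.
have mGh : ge0_mfun (fun k : borel K => G (h, k)) by exact: ge0_mfun_sectionr.
rewrite -(haar_integral_mulgl haarK s mGh) -ge0_integralZl//.
- apply: (@ge0_mfun_continuous R K K (fun u => s^-1 * u)%g _ _ mGh).1.
  exact: continuous_mulgl.
- by move=> u _; exact: mG.2.
- exact: mP.2.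
Qed.
End Convolution.

(** * Complex-valued functions *)

Lemma ae_imply d (T : measurableType d) (R : realType) (m : {measure set T -> \bar R})
    (P Q : T -> Prop) : {ae m, forall x, P x} -> (forall x, P x -> Q x) ->
  {ae m, forall x, Q x}.
Proof. by move=> mP PQ; apply: filterS mP. Qed.

Lemma ae_imply2 d (T : measurableType d) (R : realType) (m : {measure set T -> \bar R})
    (P P' Q : T -> Prop) : {ae m, forall x, P x} -> {ae m, forall x, P' x} ->
  (forall x, P x -> P' x -> Q x) -> {ae m, forall x, Q x}.
Proof. by move=> mP mP' PQ; apply: filterS2 mP mP'. Qed.

Section ComplexIntegral.
Local Open Scope complex_scope.
Context d (T : measurableType d) (R : realType).
Variable m : {measure set T -> \bar R}.
Implicit Types (f g : T -> R[i]) (z : R[i]).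

Definition cmeasurable f := measurable_fun setT (fun x => complex.Re (f x)) /\
  measurable_fun setT (fun x => complex.Im (f x)).

Lemma ReM (x y : R[i]) : complex.Re (x * y) =
  complex.Re x * complex.Re y - complex.Im x * complex.Im y.
Proof. by case: x; case: y. Qed.

Lemma ImM (x y : R[i]) : complex.Im (x * y) =
  complex.Re x * complex.Im y + complex.Im x * complex.Re y.
Proof. by case: x; case: y. Qed.

Lemma ReD (x y : R[i]) : complex.Re (x + y) = complex.Re x + complex.Re y.
Proof. by case: x; case: y. Qed.

Lemma ImD (x y : R[i]) : complex.Im (x + y) = complex.Im x + complex.Im y.
Proof. by case: x; case: y. Qed.

Lemma normcE z : normc z = Num.sqrt (complex.Re z ^+ 2 + complex.Im z ^+ 2).
Proof. by case: z. Qed.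

Lemma normr_Re_le z : `|complex.Re z| <= normc z.
Proof.
by case: z => a b /=; rewrite -sqrtr_sqr ler_sqrt ?addr_ge0 ?sqr_ge0// lerDl sqr_ge0.
Qed.

Lemma normr_Im_le z : `|complex.Im z| <= normc z.
Proof.
by case: z => a b /=; rewrite -sqrtr_sqr ler_sqrt ?addr_ge0 ?sqr_ge0// lerDr sqr_ge0.
Qed.

Lemma cmeasurable_normc f : cmeasurable f -> measurable_fun setT (fun x => normc (f x)).
Proof.
move=> [fr fi].
have -> : (fun x => normc (f x)) =
    Num.sqrt \o (fun x => complex.Re (f x) ^+ 2 + complex.Im (f x) ^+ 2).
  by apply/funext => x /=; case: (f x).
apply: measurableT_comp.
  by apply: continuous_measurable_fun; exact: sqrt_continuous.
by apply: measurable_funD; exact: measurable_funX.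
Qed.

Lemma cmeasurableM f g : cmeasurable f -> cmeasurable g -> cmeasurable (fun x => f x * g x).
Proof.
move=> [fr fi] [gr gi]; split; [under eq_fun do rewrite ReM|under eq_fun do rewrite ImM].
  by apply: measurable_funB; exact: measurable_funM.
by apply: measurable_funD; exact: measurable_funM.
Qed.

Lemma cmeasurableD f g : cmeasurable f -> cmeasurable g -> cmeasurable (fun x => f x + g x).
Proof.
move=> [fr fi] [gr gi]; split; [under eq_fun do rewrite ReD|under eq_fun do rewrite ImD];
  exact: measurable_funD.
Qed.

Lemma cmeasurable_cst z : cmeasurable (fun=> z).
Proof. by split; exact: measurable_cst. Qed.

Lemma cintegrable_cmeasurable f : cintegrable m f -> cmeasurable f.
Proof. by move=> [/measurable_int/measurable_EFinP fr /measurable_int/measurable_EFinP fi]. Qed.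

Lemma cintegrableP f : cmeasurable f ->
  cintegrable m f <-> (\int[m]_x (normc (f x))%:E < +oo)%E.
Proof.
move=> mf; have [mr mi] := mf; split=> [[/integrableP[_ fr] /integrableP[_ fi]]|foo].
- have mE (h : T -> R) : measurable_fun setT h -> measurable_fun setT (fun x => `|(h x)%:E|)%E.
    by move=> mh; apply: measurableT_comp => //; exact/measurable_EFinP.
  have := lte_add_pinfty fr fi; rewrite -ge0_integralD//; last 2 first.
    exact: mE.
    exact: mE.
  apply: le_lt_trans; apply: ge0_le_integral => //.
  + by move=> x _; rewrite lee_fin normc_ge0.
  + by apply/measurable_EFinP; exact: cmeasurable_normc.
  + by apply: emeasurable_funD; exact: mE.
  + by move=> x _; rewrite /= lee_fin normc_le_ReIm.
- have mn : measurable_fun setT (EFin \o (fun x => normc (f x))).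
    by apply/measurable_EFinP; exact: cmeasurable_normc.
  split; apply/integrableP; split.
  + exact/measurable_EFinP.
  + apply: le_lt_trans foo; apply: ge0_le_integral => //.
    * by apply: measurableT_comp => //; exact/measurable_EFinP.
    * by move=> x _; rewrite /= lee_fin normr_Re_le.
  + exact/measurable_EFinP.
  + apply: le_lt_trans foo; apply: ge0_le_integral => //.
    * by apply: measurableT_comp => //; exact/measurable_EFinP.
    * by move=> x _; rewrite /= lee_fin normr_Im_le.
Qed.

Lemma integrable_EFinZ (r : R) (h : T -> R) : m.-integrable setT (EFin \o h) ->
  m.-integrable setT (EFin \o (fun x => r * h x)).
Proof.
move=> ih; have := integrableZl measurableT r ih.
by apply: eq_integrable => // x _.
Qed.

Lemma cintegral_linear (a : R[i]) f g : cintegrable m f -> cintegrable m g ->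
  cintegral m (fun x => a * f x + g x) = a * cintegral m f + cintegral m g.
Proof.
move=> [fr fi] [gr gi]; apply/eqP; rewrite eq_complex; apply/andP; split; apply/eqP.
- rewrite ReD ReM /cintegral/=.
  under eq_Rintegral do rewrite ReD ReM.
  rewrite RintegralD//; last first.
    have := integrableB measurableT (integrable_EFinZ (complex.Re a) fr)
      (integrable_EFinZ (complex.Im a) fi).
    by apply: eq_integrable => // x _; rewrite /= EFinB.
  by rewrite RintegralB ?RintegralZl//; exact: integrable_EFinZ.
- rewrite ImD ImM /cintegral/=.
  under eq_Rintegral do rewrite ImD ImM.
  rewrite RintegralD//; last first.
    have := integrableD measurableT (integrable_EFinZ (complex.Re a) fi)
      (integrable_EFinZ (complex.Im a) fr).
    by apply: eq_integrable => // x _; rewrite /= EFinD.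
  by rewrite RintegralD ?RintegralZl//; exact: integrable_EFinZ.
Qed.

Lemma ae_eq_cintegral f g : cmeasurable f -> cmeasurable g ->
  {ae m, forall x, f x = g x} -> cintegral m f = cintegral m g.
Proof.
move=> [fr fi] [gr gi] fg; rewrite /cintegral /Rintegral; congr (fine _ +i* fine _);
  apply: ae_eq_integral => //; try exact/measurable_EFinP;
  by apply: filterS fg => x /= -> _.
Qed.

(** If the right-hand side is infinite there is nothing to prove, and otherwise [f] is integrable. A
    rotation then makes the integral a nonnegative real, so that only real parts are compared. *)
Lemma normc_cintegral_le f : cmeasurable f ->
  ((normc (cintegral m f))%:E <= \int[m]_x (normc (f x))%:E)%E.
Proof.
move=> mf; have [foo|foo] := ltP (\int[m]_x (normc (f x))%:E)%E +oo%E; last first.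
  by apply: le_trans foo; exact: leey.
have := foo; move/(iffRL (cintegrableP mf)) => intf.
set z := cintegral m f.
have [->|z0] := eqVneq z 0.
  by rewrite normc0; apply: integral_ge0 => x _; rewrite lee_fin normc_ge0.
have nz0 : 0 < normc z.
  by rewrite lt_neqAle normc_ge0 andbT eq_sym; apply: contra_neqN z0 => /eqP; exact: eq0_normc.
(* The conjugate of [z] divided by its modulus, so that [w] has modulus 1 and [w * z] equals
   [normc z]. *)
pose w : R[i] := (complex.Re z / normc z) +i* (- (complex.Im z / normc z)).
have zE : normc z ^+ 2 = complex.Re z ^+ 2 + complex.Im z ^+ 2.
  by case: z {w z0 nz0} => a b /=; rewrite sqr_sqrtr// addr_ge0 ?sqr_ge0.
have n2 : normc z ^+ 2 != 0 by rewrite expf_neq0// gt_eqF.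
have w1 : normc w = 1.
  have wr : complex.Re w = complex.Re z / normc z by [].
  have wi : complex.Im w = - (complex.Im z / normc z) by [].
  by rewrite normcE wr wi sqrrN !expr_div_n -mulrDl -zE (divff n2) sqrtr1.
have wz : complex.Re (w * z) = normc z.
  have wr : complex.Re w = complex.Re z / normc z by [].
  have wi : complex.Im w = - (complex.Im z / normc z) by [].
  rewrite ReM wr wi mulNr opprK ![_ / _ * _]mulrAC -mulrDl -!expr2 -zE expr2 mulfK//.
  by rewrite gt_eqF.
have wf x : normc (w * f x) = normc (f x) by rewrite normcM w1 mul1r.
have mwf : cmeasurable (fun x => w * f x).
  by apply: cmeasurableM => //; exact: cmeasurable_cst.
have [iwf _] : cintegrable m (fun x => w * f x).
  by apply/cintegrableP => //; under eq_integral do rewrite wf.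
have i0 : cintegrable m (cst 0) by split; exact: integrable0.
have c0 : cintegral m (cst 0) = 0.
  by rewrite /cintegral /Rintegral/= !integral0.
have := cintegral_linear w intf i0; rewrite c0 addr0 -/z => wzE.
rewrite -wz -wzE /cintegral/=.
under eq_Rintegral do rewrite addr0.
rewrite /Rintegral fineK; last exact: integrable_fin_num.
apply: (le_trans (lee_abs _)); apply: (le_trans (le_abse_integral m measurableT _)).
  by case/integrableP: iwf.
apply: ge0_le_integral => //.
- by apply: measurableT_comp => //; case/integrableP: iwf.
- by apply/measurable_EFinP; exact: cmeasurable_normc.
- by move=> x _; rewrite /= lee_fin -wf normr_Re_le.
Qed.
End ComplexIntegral.

Lemma cmeasurable_continuous (R : realType) (S T : ptopologicalType) (u : S -> T)
    (f : borel T -> R[i]) :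
  continuous u -> cmeasurable f -> cmeasurable (fun s : borel S => f (u s)).
Proof.
move=> cu [fr fi]; have mu := continuous_borel_measurable cu.
by split; [exact: (measurableT_comp fr mu)|exact: (measurableT_comp fi mu)].
Qed.

Lemma measurable_Rintegral_supp (R : realType) (X : ptopologicalType) (K : topGroupType)
    (nu : {measure set (borel K) -> \bar R}) (B : set K) (F : X * K -> R) :
  hausdorff_space K -> left_haar nu -> sigma_clopen B ->
  measurable_fun setT (F : borel (X * K)%type -> R) ->
  (forall x y, ~ B y -> F (x, y) = 0) ->
  measurable_fun setT (fun x : borel X => \int[nu]_y F (x, y)).
Proof.
move=> hK haarK BB mF FB; apply: measurableT_comp; first exact: fine_measurable.
apply: (@measurable_integral_supp R X K nu hK haarK B BB (fun z => (F z)%:E)).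
  exact/measurable_EFinP.
by move=> x y /FB ->.
Qed.

Section ComplexConvolution.
Local Open Scope complex_scope.
Context (R : realType) (H K : topGroupType) (tau : autHom H K).
Variables (muH : {measure set (borel H) -> \bar R}) (muK : {measure set (borel K) -> \bar R}).
Hypotheses (hH : hausdorff_space H) (hK : hausdorff_space K).
Hypotheses (haarH : left_haar muH) (haarK : left_haar muK).
Variable delta : H -> R.
Hypothesis mdelta : measurable_fun setT (delta : borel H -> R).
Hypothesis delta_gt0 : forall h, 0 < delta h.
Variables (A : set H) (B : set K).
Hypotheses (sA : sigma_subgroup A) (sB : sigma_subgroup B).

Let AA := sigma_subgroup_clopen sA.
Let BB := sigma_subgroup_clopen sB.

Definition csupported (f : H * K -> R[i]) := [/\ cmeasurable (f : borel (H * K)%type -> R[i]),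
  forall h k, ~ A h -> f (h, k) = 0 & forall h k, ~ B k -> f (h, k) = 0].

Definition enorm (f : H * K -> R[i]) (x : H * K) : \bar R := (normc (f x))%:E.

Lemma enorm_nonneg f : csupported f -> nonneg_supp A B (enorm f).
Proof.
move=> [mf fA fB]; split; last first.
  by split=> h k hk; rewrite /enorm; [rewrite fA|rewrite fB]; rewrite // normc0.
split; last by move=> x; rewrite lee_fin normc_ge0.
by apply/measurable_EFinP; exact: cmeasurable_normc.
Qed.

Definition inner f g (x : H * K) (t : H) : R[i] :=
  group_conv muK (fun k => f (t, k)) (fun k => g (x.1, k)) x.2.

(** The variables are [((x, t), s)] with [x = (h, k)]. Keeping all of them makes the measurability
    of the successive integrals, over [s] and then over [t], two instances of
    [measurable_Rintegral_supp]. *)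
Let integrand f g (z : H * K * H * K) : R[i] :=
  f (z.1.2, z.2) * g (z.1.1.1, (z.2^-1 * z.1.1.2)%g).

Let integrandB f g z s : csupported f -> ~ B s -> integrand f g (z, s) = 0.
Proof. by move=> [_ _ fB] Bs; rewrite /integrand/= fB// mul0r. Qed.

Let measurable_integrand f g : csupported f -> csupported g ->
  cmeasurable (integrand f g : borel (H * K * H * K)%type -> R[i]).
Proof.
move=> [mf _ _] [mg _ _]; apply: cmeasurableM.
  apply: (@cmeasurable_continuous R (H * K * H * K)%type (H * K)%type
    (fun z => (z.1.2, z.2)) _ _ mf).
  by solve_cont.
apply: (@cmeasurable_continuous R (H * K * H * K)%type (H * K)%type
    (fun z => (z.1.1.1, (z.2^-1 * z.1.1.2)%g)) _ _ mg).
by solve_cont.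
Qed.

Lemma measurable_inner f g : csupported f -> csupported g ->
  cmeasurable (fun z : borel (H * K * H)%type => inner f g z.1 z.2).
Proof.
move=> sf sg; have [mr mi] := measurable_integrand sf sg; split.
- apply: (@measurable_Rintegral_supp R (H * K * H)%type K muK B
    (fun z => complex.Re (integrand f g z))) => // z s Bs.
  by rewrite integrandB.
- apply: (@measurable_Rintegral_supp R (H * K * H)%type K muK B
    (fun z => complex.Im (integrand f g z))) => // z s Bs.
  by rewrite integrandB.
Qed.

Lemma innerA f g x t : csupported f -> ~ A t -> inner f g x t = 0.
Proof.
move=> [_ fA _] At; rewrite /inner /group_conv /cintegral /Rintegral.
by rewrite !integral0_eq// => s _; rewrite fA// mul0r.
Qed.

Let weighted_inner f g (z : H * K * H) := inner f g z.1 z.2 * (delta z.2)%:C.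

Let measurable_weighted_inner f g : csupported f -> csupported g ->
  cmeasurable (weighted_inner f g : borel (H * K * H)%type -> R[i]).
Proof.
move=> sf sg; apply: cmeasurableM; first exact: measurable_inner.
split; last exact: measurable_cst.
apply: (@measurableT_comp _ _ _ _ _ _ (delta : borel H -> R)) => //.
apply: (@continuous_borel_measurable (H * K * H)%type H snd).
by move=> z; exact: cvg_snd.
Qed.

Lemma measurable_tau_conv f g : csupported f -> csupported g ->
  cmeasurable (tau_conv (tau := tau) muH muK delta f g : borel (H * K)%type -> R[i]).
Proof.
move=> sf sg; have [mr mi] := measurable_weighted_inner sf sg; split.
- apply: (@measurable_Rintegral_supp R (H * K)%type H muH A
    (fun z => complex.Re (weighted_inner f g z))) => // z s Bs.
  by rewrite /weighted_inner innerA// mul0r.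
- apply: (@measurable_Rintegral_supp R (H * K)%type H muH A
    (fun z => complex.Im (weighted_inner f g z))) => // z s Bs.
  by rewrite /weighted_inner innerA// mul0r.
Qed.

Lemma measurable_weighted_innerr f g x : csupported f -> csupported g ->
  cmeasurable (fun t : borel H => weighted_inner f g (x, t)).
Proof.
move=> sf sg.
apply: (@cmeasurable_continuous R H (H * K * H)%type (fun t => (x, t))).
  exact: continuous_pairr.
exact: measurable_weighted_inner.
Qed.

Lemma measurable_integrandr f g x t : csupported f -> csupported g ->
  cmeasurable (fun s : borel K => f (t, s) * g (x.1, (s^-1 * x.2)%g)).
Proof.
move=> sf sg.
apply: (@cmeasurable_continuous R K (H * K * H * K)%type (fun s => (x, t, s)) (integrand f g)).
  exact: continuous_pairr.
exact: measurable_integrand.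
Qed.

Lemma normc_inner_le f g x t : csupported f -> csupported g ->
  ((normc (inner f g x t))%:E <=
    \int[muK]_s (enorm f (t, s) * enorm g (x.1, (s^-1 * x.2)%g)))%E.
Proof.
move=> sf sg; apply: le_trans (normc_cintegral_le muK (measurable_integrandr x t sf sg)) _.
by under eq_integral do rewrite normcM EFinM.
Qed.

Let normc_weighted_inner_le f g x t : csupported f -> csupported g ->
  ((normc (weighted_inner f g (x, t)))%:E <=
    \int[muK]_s (enorm f (t, s) * enorm g (x.1, (s^-1 * x.2)%g)) * (delta t)%:E)%E.
Proof.
move=> sf sg; rewrite normcM EFinM.
have -> : normc (delta t)%:C = delta t.
  by rewrite normcE/= expr0n addr0 sqrtr_sqr ger0_norm// ltW.
by apply: lee_wpmul2r; [rewrite lee_fin ltW|exact: normc_inner_le].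
Qed.

Lemma ge0_mfun_conv_inner f g x : csupported f -> csupported g ->
  ge0_mfun (fun t : borel H =>
    (\int[muK]_s (enorm f (t, s) * enorm g (x.1, (s^-1 * x.2)%g)) * (delta t)%:E)%E).
Proof.
move=> /enorm_nonneg[mf [fA fB]] /enorm_nonneg[mg _]; apply: ge0_mfunM; last first.
  by split=> [|h]; [exact/measurable_EFinP|rewrite lee_fin ltW].
apply: (@ge0_mfun_integral_supp R H K muK hK haarK B BB
   (fun z => (enorm f z * enorm g (x.1, (z.2^-1 * x.2)%g))%E)); last first.
  by move=> t s /fB ->; rewrite mul0e.
apply: ge0_mfunM => //.
apply: (@ge0_mfun_continuous R (H * K)%type (H * K)%type
  (fun z => (x.1, (z.2^-1 * x.2)%g)) _ _ mg).
by solve_cont.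
Qed.

(* This also holds where the integrals of [tau_conv] diverge and take junk
   values: the right-hand side is then infinite. *)
Lemma normc_tau_conv_le f g x : csupported f -> csupported g ->
  ((normc (tau_conv (tau := tau) muH muK delta f g x))%:E <=
    conv muH muK delta (enorm f) (enorm g) x)%E.
Proof.
move=> sf sg; have mw := measurable_weighted_innerr x sf sg.
apply: le_trans (normc_cintegral_le muH mw) _.
have [mI I0] := ge0_mfun_conv_inner x sf sg.
apply: ge0_le_integral => //.
- by move=> t _; rewrite lee_fin normc_ge0.
- by apply/measurable_EFinP; exact: cmeasurable_normc.
- by move=> t _; exact: normc_weighted_inner_le.
Qed.

(** The bound by [conv] holds at every point, so the vanishing of [conv] off [A] and off [B] passes
    to [tau_conv]. *)
Lemma csupported_tau_conv f g : csupported f -> csupported g ->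
  csupported (tau_conv (tau := tau) muH muK delta f g).
Proof.
move=> sf sg; split; first exact: measurable_tau_conv.
- move=> h k Ah; apply: eq0_normc; apply/eqP; rewrite eq_le normc_ge0 andbT -lee_fin.
  apply: le_trans (normc_tau_conv_le _ sf sg) _.
  have [_ [gA _]] := enorm_nonneg sg.
  rewrite /conv integral0_eq// => t _; rewrite integral0_eq ?mul0e// => s _.
  by rewrite gA// mule0.
- move=> h k Bk; apply: eq0_normc; apply/eqP; rewrite eq_le normc_ge0 andbT -lee_fin.
  apply: le_trans (normc_tau_conv_le _ sf sg) _.
  have [_ [_ gB]] := enorm_nonneg sg; have [_ [_ fB]] := enorm_nonneg sf.
  rewrite /conv integral0_eq// => t _; rewrite integral0_eq ?mul0e// => s _.
  have [Bs|Bs] := pselect (B s); last by rewrite fB// mul0e.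
  by rewrite gB ?mule0//= => /(subgroup_divlP sB Bs).
Qed.

(** A finite outer integral forces its integrand to be finite for almost every [t], and
    [delta t > 0] then makes the inner integral finite as well. *)
Lemma tau_conv_convergesP f g x : csupported f -> csupported g ->
  (conv muH muK delta (enorm f) (enorm g) x < +oo)%E ->
  tau_conv_converges (tau := tau) muH muK delta f g x.
Proof.
move=> sf sg coo; have [mI I0] := ge0_mfun_conv_inner x sf sg.
have intI : muH.-integrable setT (fun t : borel H =>
    (\int[muK]_s (enorm f (t, s) * enorm g (x.1, (s^-1 * x.2)%g)) * (delta t)%:E)%E).
  apply/integrableP; split=> //; under eq_integral do rewrite gee0_abs//; exact: coo.
split.
- have := integrable_ae measurableT intI; apply: filterS => t /(_ Logic.I) tfin.
  apply/cintegrableP; first exact: measurable_integrandr.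
  under eq_integral do rewrite normcM EFinM.
  have : (0 <= \int[muK]_s (enorm f (t, s) * enorm g (x.1, (s^-1 * x.2)%g)))%E.
    by apply: integral_ge0 => s _; rewrite mule_ge0// lee_fin normc_ge0.
  move: tfin; rewrite -/(enorm _ _).
  case: (\int[muK]_s _)%E => // [r _ _|]; first exact: ltry.
  by rewrite gt0_mulye// lte_fin.
- have mw := measurable_weighted_innerr x sf sg.
  apply/cintegrableP => //; apply: le_lt_trans coo.
  apply: ge0_le_integral => //.
  + by move=> t _; rewrite lee_fin normc_ge0.
  + by apply/measurable_EFinP; exact: cmeasurable_normc.
  + by move=> t _; exact: normc_weighted_inner_le.
Qed.

(** Stating the relation on the integrands covers linearity in either argument. The inner integrals
    combine linearly only for those [t] at which both converge, so the outer integrands are compared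
    almost everywhere. *)
Lemma tau_conv_linear (a : R[i]) f1 g1 f2 g2 f3 g3 x :
  csupported f1 -> csupported g1 -> csupported f2 -> csupported g2 ->
  csupported f3 -> csupported g3 ->
  tau_conv_converges (tau := tau) muH muK delta f1 g1 x ->
  tau_conv_converges (tau := tau) muH muK delta f2 g2 x ->
  (forall t s, f3 (t, s) * g3 (x.1, (s^-1 * x.2)%g) =
    a * (f1 (t, s) * g1 (x.1, (s^-1 * x.2)%g)) + f2 (t, s) * g2 (x.1, (s^-1 * x.2)%g)) ->
  tau_conv (tau := tau) muH muK delta f3 g3 x =
    a * tau_conv (tau := tau) muH muK delta f1 g1 x +
    tau_conv (tau := tau) muH muK delta f2 g2 x.
Proof.
move=> s1 t1 s2 t2 s3 t3 [c1 d1] [c2 d2] E.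
rewrite -cintegral_linear//; apply: ae_eq_cintegral.
- exact: measurable_weighted_innerr.
- apply: cmeasurableD; last exact: measurable_weighted_innerr.
  apply: cmeasurableM; first exact: cmeasurable_cst.
  exact: measurable_weighted_innerr.
apply: (ae_imply2 c1 c2) => t i1 i2.
rewrite mulrA -mulrDl; congr (_ * _).
rewrite /group_conv /section_at -cintegral_linear//.
by congr (cintegral _ _); apply/funext => s; exact: E.
Qed.
End ComplexConvolution.

(** * Completeness of L1 *)

Section Completeness.
Context d (T : measurableType d) (R : realType).
Variable m : {measure set T -> \bar R}.

(** The core of the Riesz-Fischer argument: summable increments force convergence wherever [G] is
    finite, and [G] dominates the sequence. The same [G] will serve for real and imaginary parts. *)
Lemma rapid_sequence_cvg (u : nat -> T -> R) (G : T -> \bar R) :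
  (forall n, measurable_fun setT (u n)) -> measurable_fun setT G ->
  (\int[m]_x G x < +oo)%E ->
  (forall x, \sum_(0 <= n <oo) (`|u n.+1 x - u n x|)%:E + (`|u 0%N x|)%:E <= G x)%E ->
  exists2 v : T -> R, m.-integrable setT (EFin \o v) &
    (\int[m]_x (`|u n x - v x|)%:E)%E @[n --> \oo] --> 0%E.
Proof.
move=> mu mG Goo uG.
have partial_le x n : ((\sum_(0 <= k < n) `|u k.+1 x - u k x|)%:E + (`|u 0%N x|)%:E <= G x)%E.
  apply: le_trans (uG x); rewrite leeD2r// -sumEFin.
  exact: (nneseries_lim_ge (u_ := fun n => (`|u n.+1 x - u n x|)%:E)).
have G0 x : (0 <= G x)%E.
  by apply: le_trans (partial_le x 0%N); rewrite big_geq// add0e lee_fin.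
have uleG x n : ((`|u n x|)%:E <= G x)%E.
  apply: le_trans (partial_le x n); rewrite -EFinD lee_fin.
  rewrite -[X in `|X|](subrK (u 0%N x)) -(telescope_sumr (fun n => u n x) (leq0n n)).
  by apply: le_trans (ler_normD _ _) _; rewrite lerD2r ler_norm_sum.
have ucvg x : (G x < +oo)%E -> cvgn (u ^~ x).
  move=> Gx; pose w k := u k.+1 x - u k x.
  have -> : u ^~ x = fun n => series w n + u 0%N x.
    by apply/funext => n; rewrite /series/= telescope_sumr// subrK.
  apply: is_cvgD; last exact: is_cvg_cst.
  apply: normed_cvg; apply: nondecreasing_is_cvgn.
    by apply: nondecreasing_series => k _ _ /=.
  exists (fine (G x)) => _ [n _ <-].
  rewrite -lee_fin fineK ?ge0_fin_numE//; apply: le_trans (partial_le x n).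
  by rewrite /series/= leeDl// lee_fin.
pose S := [set x | (G x < +oo)%E].
have mS : measurable S.
  rewrite (_ : S = setT `&` G @^-1` [set y | (y < +oo)%E]); last by rewrite setTI.
  by apply: mG => //; rewrite -set_itvNyo; exact: emeasurable_itv.
(* Cut off where [G] is infinite, the sequence converges at every point, so its limit [v] is
   measurable without an exceptional set. *)
pose h n x := u n x * \1_S x.
have hcvg x : cvgn (h ^~ x).
  have [Sx|Sx] := pselect (S x).
    have -> : h ^~ x = u ^~ x by apply/funext => n; rewrite /h indicE mem_set// mulr1.
    exact: ucvg.
  have -> : h ^~ x = cst 0 by apply/funext => n; rewrite /h indicE memNset// mulr0.
  exact: is_cvg_cst.
pose v x := limn (h ^~ x).
have mv : measurable_fun setT v.
  apply: (measurable_fun_cvg (h := h)) => [n|x _]; last exact: hcvg.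
  by apply: measurable_funM => //; exact: measurable_indic.
have intG : m.-integrable setT G.
  by apply/integrableP; split=> //; under eq_integral do rewrite gee0_abs//.
have [] := @dominated_convergence _ _ _ m setT measurableT (fun n => EFin \o u n) (EFin \o v) G.
- by move=> n; exact/measurable_EFinP.
- exact/measurable_EFinP.
- have := integrable_ae measurableT intG; apply: filterS => x /(_ Logic.I) Gfin _.
  have Sx : S x by rewrite /S/= -ge0_fin_numE.
  have hu : h ^~ x = u ^~ x by apply/funext => n; rewrite /h indicE mem_set// mulr1.
  have vx : u ^~ x @ \oo --> v x by rewrite -hu; exact: hcvg.
  apply: cvg_EFin; first by apply: nearW => n.
  exact: vx.
- exact: intG.
- by apply: aeW => x n _ /=; exact: uleG.
move=> iv + _ => ucv; exists v => //.
Qed.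

Local Open Scope complex_scope.
Local Open Scope quotient_scope.

Lemma L1_normE (f g : L1fun m) :
  `|\pi_(L1 m) f - \pi_(L1 m) g| = (\int[m]_x normc (f x - g x))%:C.
Proof.
rewrite -raddfB -[`|_|]/(L1norm _) L1normE; congr (_%:C).
Qed.

Lemma L1fun_integral_fin (f g : L1fun m) :
  (\int[m]_x normc (f x - g x))%:E = (\int[m]_x (normc (f x - g x))%:E)%E.
Proof.
rewrite /Rintegral fineK//; apply: integrable_fin_num => //.
by have := integrable_normc (f - g); apply: eq_integrable.
Qed.

Lemma L1_complete (F : set_system (L1 m)) : ProperFilter F -> cauchy F -> cvg F.
Proof.
move=> FF /cauchyP Fc.
(* Successive balls of radii [e n] and [e n.+1] both belong to [F], hence meet, so their centres are
   at distance at most [2 * e n], that is [2 ^- n.+1]. These bounds have sum at most 1. *)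
pose e n : R := ((2 ^ n.+2)%:R)^-1.
have e0 n : 0 < e n by rewrite invr_gt0 ltr0n expn_gt0.
have /choice[x Fx] : forall n, exists x : L1 m, F (ball x (e n)%:C).
  by move=> n; apply: Fc; rewrite ltcR.
pose f n : L1fun m := repr (x n).
have fx n : x n = \pi_(L1 m) (f n) by rewrite reprK.
have dist n : (\int[m]_t (normc (f n.+1 t - f n t))%:E <= (1 / (2 ^ n.+1)%:R)%:E)%E.
  rewrite -L1fun_integral_fin lee_fin -lecR -L1_normE -!fx.
  have [z [zn zn1]] := filter_ex (filterI (Fx n) (Fx n.+1)).
  move: zn zn1; rewrite -ball_normE /= => zn zn1.
  rewrite -(subrKA z) (le_trans (ler_normD _ _))//.
  have -> : (1 / (2 ^ n.+1)%:R)%:C = (e n)%:C + (e n)%:C :> R[i].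
    rewrite -rmorphD; congr (_%:C).
    by rewrite /e (expnS 2 n.+1) natrM; field; rewrite pnatr_eq0 -lt0n expn_gt0.
  rewrite lerD//; last by rewrite distrC ltW.
  rewrite ltW//; apply: (lt_le_trans zn1).
  rewrite lecR lef_pV2 ?posrE ?ltr0n ?expn_gt0// ler_nat.
  by rewrite leq_exp2l.
pose G t := (\sum_(0 <= n <oo) (normc (f n.+1 t - f n t))%:E + (normc (f 0%N t))%:E)%E.
have mf n : cmeasurable (f n) by apply: cintegrable_cmeasurable; exact: L1fun_integrable.
have mD n : measurable_fun setT (fun t => (normc (f n.+1 t - f n t))%:E).
  have := cintegrable_cmeasurable (L1fun_integrable (f n.+1 - f n)).
  by move=> /cmeasurable_normc ?; exact/measurable_EFinP.
have mG : measurable_fun setT G.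
  apply: emeasurable_funD; last by apply/measurable_EFinP; exact: cmeasurable_normc.
  by apply: ge0_emeasurable_sum => // k t _ _; rewrite lee_fin normc_ge0.
have Goo : (\int[m]_t G t < +oo)%E.
  rewrite ge0_integralD//; last 4 first.
  - by move=> t _; apply: nneseries_ge0 => k _ _; rewrite lee_fin normc_ge0.
  - by apply: ge0_emeasurable_sum => // k t _ _; rewrite lee_fin normc_ge0.
  - by move=> t _; rewrite lee_fin normc_ge0.
  - by apply/measurable_EFinP; exact: cmeasurable_normc.
  rewrite lte_add_pinfty//; last exact/(cintegrableP _ (mf 0%N))/L1fun_integrable.
  rewrite integral_nneseries//; last by move=> n t _; rewrite lee_fin normc_ge0.
  apply: (@le_lt_trans _ _ 1%:E); last exact: ltry.
  apply: le_trans (epsilon_trick0 xpredT ler01).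
  by apply: lee_nneseries => // n _ _; apply: integral_ge0 => t _; rewrite lee_fin normc_ge0.
(* To be used with [p] the real part and with [p] the imaginary part. *)
have part (p : R[i] -> R) : (forall y z, p (y - z) = p y - p z) ->
    (forall z, `|p z| <= normc z) -> forall t,
    (\sum_(0 <= n <oo) (`|p (f n.+1 t) - p (f n t)|)%:E + (`|p (f 0%N t)|)%:E <= G t)%E.
  move=> pB pn t; apply: leeD; last by rewrite lee_fin pn.
  apply: lee_nneseries => n _; first by rewrite lee_fin.
  by rewrite lee_fin -pB.
have ReB (y z : R[i]) : complex.Re (y - z) = complex.Re y - complex.Re z.
  by case: y; case: z.
have ImB (y z : R[i]) : complex.Im (y - z) = complex.Im y - complex.Im z.
  by case: y; case: z.
have [vr ivr vrcv] := rapid_sequence_cvg (fun n => (mf n).1) mG Goo (part _ ReB (@normr_Re_le R)).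
have [vi ivi vicv] := rapid_sequence_cvg (fun n => (mf n).2) mG Goo (part _ ImB (@normr_Im_le R)).
have vP : (fun t => vr t +i* vi t) \in @L1pred _ T R m by apply/asboolP.
pose v : L1fun m := MkL1fun vP.
have vle n : (\int[m]_t (normc (f n t - v t))%:E <=
    \int[m]_t (`|complex.Re (f n t) - vr t|)%:E + \int[m]_t (`|complex.Im (f n t) - vi t|)%:E)%E.
  have mvr : measurable_fun setT vr by have /measurable_int/measurable_EFinP := ivr.
  have mvi : measurable_fun setT vi by have /measurable_int/measurable_EFinP := ivi.
  have mr : measurable_fun setT (fun t => (`|complex.Re (f n t) - vr t|)%:E).
    apply/measurable_EFinP; apply: measurableT_comp => //.
    by apply: measurable_funB => //; case: (mf n).
  have mi : measurable_fun setT (fun t => (`|complex.Im (f n t) - vi t|)%:E).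
    apply/measurable_EFinP; apply: measurableT_comp => //.
    by apply: measurable_funB => //; case: (mf n).
  rewrite -ge0_integralD//; apply: ge0_le_integral => //.
  - by move=> t _; rewrite lee_fin normc_ge0.
  - have := cintegrable_cmeasurable (L1fun_integrable (f n - v)).
    by move=> /cmeasurable_normc ?; exact/measurable_EFinP.
  - exact: emeasurable_funD.
  - move=> t _; rewrite -EFinD lee_fin; apply: le_trans (normc_le_ReIm _) _.
    by rewrite ReB ImB.
have cv : (\int[m]_t (normc (f n t - v t))%:E)%E @[n --> \oo] --> 0%E.
  apply: (@squeeze_cvge _ _ _ _ (cst 0%E) _ (fun n =>
    \int[m]_t (`|complex.Re (f n t) - vr t|)%:E + \int[m]_t (`|complex.Im (f n t) - vi t|)%:E)%E).
  - apply: nearW => n; rewrite vle andbT; apply: integral_ge0 => t _.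
    by rewrite lee_fin normc_ge0.
  - exact: cvg_cst.
  - by rewrite -(adde0 0%E); apply: (cvgeD _ vrcv vicv).
apply/cvg_ex; exists (\pi_(L1 m) v); apply/fcvg_ballP => eps eps0.
have epsE : eps = (complex.Re eps)%:C.
  by case: eps eps0 => a b; rewrite ltcE/= => /andP[/eqP -> _].
have re0 : 0 < complex.Re eps by move: eps0; rewrite ltcE => /andP[].
move: cv => /fine_cvgP[cvfin cv].
have : \forall n \near \oo, (\int[m]_t normc (f n t - v t)) < complex.Re eps / 2.
  exact: (cvgr_lt _ cv _ (divr_gt0 re0 (ltr0Sn R 1))).
move=> [N1 _ HN1].
have : \forall n \near \oo, e n < complex.Re eps / 2.
  have := near_infty_natSinv_lt (PosNum (divr_gt0 re0 (ltr0Sn R 1))).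
  apply: filterS => n /=; apply: le_lt_trans; rewrite /e.
  rewrite lef_pV2 ?posrE ?ltr0n ?expn_gt0// ler_nat.
  by apply: (leq_trans (ltnW (ltn_expl n.+1 (ltnSn 1)))); rewrite leq_exp2l.
move=> [N2 _ HN2]; pose n := maxn N1 N2.
apply: filterS (Fx n) => y; rewrite -!ball_normE/= => xy.
rewrite -(subrKA (x n)) epsE (splitr (complex.Re eps)) rmorphD/=.
apply: (le_lt_trans (ler_normD _ _)); apply: ltrD.
  rewrite distrC fx L1_normE ltcR; apply: HN1; exact: leq_maxl.
apply: (lt_trans xy); rewrite ltcR; apply: HN2; exact: leq_maxr.
Qed.
End Completeness.

(** * The convolution algebra *)

Definition nonneg_valued (R : realType) (T : Type) (f : T -> R[i]) :=
  forall x, f x = (normc (f x))%:C%C.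

Section NonnegativeClasses.
Local Open Scope complex_scope.
Local Open Scope quotient_scope.
Context d (T : measurableType d) (R : realType).
Variable m : {measure set T -> \bar R}.

Lemma normc_real (r : R) : 0 <= r -> normc r%:C = r.
Proof. by move=> r0; rewrite normcE/= expr0n addr0 sqrtr_sqr ger0_norm. Qed.

Lemma L1_piZD (a : R[i]) (f g : L1fun m) :
  \pi_(L1 m) (a *: f + g) = a *: \pi_(L1 m) f + \pi_(L1 m) g.
Proof. by rewrite raddfD; congr (_ + _); exact: esym (L1scaleE a f). Qed.

Lemma L1fun_nonneg (r : T -> R) : (forall x, 0 <= r x) ->
  m.-integrable setT (EFin \o r) ->
  exists2 f : L1fun m, nonneg_valued f & forall x, f x = (r x)%:C.
Proof.
move=> r0 ir; have rP : (fun t => (r t)%:C) \in @L1pred _ T R m.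
  by apply/asboolP; split=> //; exact: integrable0.
exists (MkL1fun rP) => // x.
by suff : (r x)%:C = (normc (r x)%:C)%:C by []; rewrite normc_real.
Qed.

(** Real and imaginary parts are split into positive and negative parts, giving four nonnegative
    functions with coefficients [1], [-1], ['i] and [- 'i]. *)
Lemma L1_nonneg_ind (P : L1 m -> Prop) :
  (forall a x y, P x -> P y -> P (a *: x + y)) ->
  (forall f : L1fun m, nonneg_valued f -> P (\pi_(L1 m) f)) -> forall x, P x.
Proof.
move=> PZD Pnn; elim/quotW => f; have [ir ii] := L1fun_integrable f.
have part (h : T -> R) : m.-integrable setT (EFin \o h) ->
    exists2 g : L1fun m, nonneg_valued g & forall x, g x = (Num.max (h x) 0)%:C.
  move=> ih; apply: (@L1fun_nonneg (fun x => Num.max (h x) 0)).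
    by move=> x; rewrite le_max lexx orbT.
  have mh : measurable_fun setT h by have /measurable_int/measurable_EFinP := ih.
  apply: le_integrable ih => //.
    by apply/measurable_EFinP; exact: measurable_maxr.
  move=> x _; rewrite /= lee_fin; case: (leP (h x) 0) => h0.
    by rewrite normr0 normr_ge0.
  by [].
have iN (h : T -> R) : m.-integrable setT (EFin \o h) ->
    m.-integrable setT (EFin \o (fun x => - h x)).
  by move=> ih; have := integrableN ih; apply: eq_integrable.
have [p1 n1 E1] := part _ ir; have [p2 n2 E2] := part _ (iN _ ir).
have [p3 n3 E3] := part _ ii; have [p4 n4 E4] := part _ (iN _ ii).
have n0 : nonneg_valued (0 : L1fun m).
  by move=> x; suff : (0 : R[i]) = (normc (0 : R[i]))%:C by []; rewrite normc0.
(* The final [0], itself nonnegative-valued, puts the sum in the nested form [a *: x + y] that the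
   closure hypothesis handles. *)
have -> : \pi_(L1 m) f = \pi_(L1 m) (1 *: p1 + (- 1 *: p2 + ('i *: p3 + (- 'i *: p4 + 0)))).
  apply/L1piP; apply: aeW => x.
  rewrite -[RHS]/(1 * p1 x + (- 1 * p2 x + ('i * p3 x + (- 'i * p4 x + 0)))) E1 E2 E3 E4.
  have pn (r : R) : r = Num.max r 0 - Num.max (- r) 0.
    by case: (leP r 0) => r0; case: (leP (- r) 0) => r1; lra.
  case: (f x) => a b /=; rewrite {1}(pn a) {1}(pn b).
  by simpc; apply/eqP; rewrite eq_complex/=; apply/andP; split; apply/eqP; ring.
rewrite !L1_piZD; by do 4! [apply: (PZD); first exact: (Pnn)]; exact: (Pnn).
Qed.
End NonnegativeClasses.

(** * The extended convolution and null sets *)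

Section ConvolutionAe.
Context (R : realType) (H K : topGroupType) (tau : autHom H K).
Variables (muH : {measure set (borel H) -> \bar R}) (muK : {measure set (borel K) -> \bar R}).
Hypotheses (hH : hausdorff_space H) (hK : hausdorff_space K).
Hypotheses (haarH : left_haar muH) (haarK : left_haar muK).
Variable delta : H -> R.
Hypothesis mdelta : measurable_fun setT (delta : borel H -> R).
Hypothesis delta_gt0 : forall h, 0 < delta h.
Variable mu : {measure set (borel (semidirect tau)) -> \bar R}.
Hypothesis hmu : is_semidirect_haar muH muK delta mu.
Variables (A : set H) (B : set K).
Hypotheses (sA : sigma_subgroup A) (sB : sigma_subgroup B).
Local Open Scope ereal_scope.

Local Notation econv := (conv muH muK delta).

Lemma nonneg_suppD (F G : H * K -> \bar R) :
  nonneg_supp A B F -> nonneg_supp A B G -> nonneg_supp A B (F \+ G).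
Proof.
move=> [[mF F0] [FA FB]] [[mG G0] [GA GB]]; split.
  by split=> [|x]; [exact: emeasurable_funD|exact: adde_ge0].
by split=> h k hk /=; [rewrite FA// GA// adde0|rewrite FB// GB// adde0].
Qed.

Lemma convDl (F F' G : H * K -> \bar R) x :
  nonneg_supp A B F -> nonneg_supp A B F' -> nonneg_supp A B G ->
  econv (F \+ F') G x = econv F G x + econv F' G x.
Proof.
case: x => h k sF sF' sG; have sFF' := nonneg_suppD sF sF'.
rewrite !(convE hH hK haarH haarK mdelta delta_gt0 sA sB)//.
have [mP PB] := proj_nonneg hH haarH mdelta delta_gt0 sA sF.
have [mP' PB'] := proj_nonneg hH haarH mdelta delta_gt0 sA sF'.
have mdE : ge0_mfun (fun h : borel H => (delta h)%:E).
  by split=> [|t]; [exact/measurable_EFinP|rewrite lee_fin ltW].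
have -> : proj muH delta (F \+ F') = proj muH delta F \+ proj muH delta F'.
  apply/funext => s; rewrite /proj/=.
  have [mf f0] := ge0_mfunM (ge0_mfun_sectionl s sF.1) mdE.
  have [mf' f0'] := ge0_mfunM (ge0_mfun_sectionl s sF'.1) mdE.
  rewrite -ge0_integralD//; apply: eq_integral => t _.
  by rewrite ge0_muleDl//; [exact: sF.1.2|exact: sF'.1.2].
rewrite /convK/=.
have mGk : ge0_mfun (fun s : borel K => G (h, (s^-1 * k)%g)).
  apply: (@ge0_mfun_continuous R K (H * K)%type (fun s => (h, (s^-1 * k)%g)) _ _ sG.1).
  by solve_cont.
have [mf f0] := ge0_mfunM mP mGk; have [mf' f0'] := ge0_mfunM mP' mGk.
rewrite -ge0_integralD//; apply: eq_integral => s _.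
by rewrite ge0_muleDl//; [exact: mP.2|exact: mP'.2].
Qed.

Lemma convDr (F G G' : H * K -> \bar R) x :
  nonneg_supp A B F -> nonneg_supp A B G -> nonneg_supp A B G' ->
  econv F (G \+ G') x = econv F G x + econv F G' x.
Proof.
case: x => h k sF sG sG'; have sGG' := nonneg_suppD sG sG'.
rewrite !(convE hH hK haarH haarK mdelta delta_gt0 sA sB)//.
have [mP PB] := proj_nonneg hH haarH mdelta delta_gt0 sA sF.
rewrite /convK/=.
have cu : continuous (fun s : K => (h, (s^-1 * k)%g)) by solve_cont.
have mGk : ge0_mfun (fun s : borel K => G (h, (s^-1 * k)%g)).
  exact: (@ge0_mfun_continuous R K (H * K)%type _ _ cu sG.1).
have mGk' : ge0_mfun (fun s : borel K => G' (h, (s^-1 * k)%g)).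
  exact: (@ge0_mfun_continuous R K (H * K)%type _ _ cu sG'.1).
have [mf f0] := ge0_mfunM mP mGk; have [mf' f0'] := ge0_mfunM mP mGk'.
rewrite -ge0_integralD//; apply: eq_integral => s _.
by rewrite ge0_muleDr//; [exact: sG.1.2|exact: sG'.1.2].
Qed.

Lemma conv_ae_eq0 (F G : H * K -> \bar R) :
  nonneg_supp A B F -> nonneg_supp A B G ->
  \int[mu]_x F x * \int[mu]_x G x = 0 -> {ae mu, forall x, econv F G x = 0}.
Proof.
move=> sF sG FG0.
have [[mc c0] _] := conv_nonneg hH hK haarH haarK mdelta delta_gt0 sA sB sF sG.
have : \int[mu]_x `|econv F G x| = 0.
  under eq_integral do rewrite gee0_abs//.
  by rewrite (integral_conv hH hK haarH haarK mdelta delta_gt0 hmu sA sB sF sG).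
move/(ae_eq_integral_abs mu measurableT mc).
by apply: filterS => x; exact.
Qed.

(* [J] is infinite exactly where [F] and [F'] differ, so that [F + J = F' + J]
   everywhere while [J] does not contribute to the integrals. *)
Lemma ae_eq_absorber (F F' : H * K -> \bar R) :
  nonneg_supp A B F -> nonneg_supp A B F' -> {ae mu, forall x, F x = F' x} ->
  exists J, [/\ nonneg_supp A B J, \int[mu]_x J x = 0 & F \+ J = F' \+ J].
Proof.
move=> [[mF F0] [FA FB]] [[mF' F0'] [FA' FB']] FF'.
pose Z : set (borel (H * K)%type) := [set x | F x != F' x].
have mZ : measurable Z by have := measurable_neqe measurableT mF mF'; rewrite setTI.
have Z0 : mu Z = 0.
  apply/negligibleP => //; move: FF'; rewrite /almost_everywhere/=.
  by apply: negligibleS => x /= /eqP.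
pose J x := +oo * (\1_Z x)%:E : \bar R.
have mJ1 : measurable_fun setT (fun x : borel (H * K)%type => (\1_Z x)%:E : \bar R).
  exact/measurable_EFinP.
exists J; split.
- split; first split.
  + exact: measurable_funeM.
  + by move=> x; rewrite mule_ge0// lee_fin.
  + split=> h k hk; rewrite /J indicE memNset ?mule0// /Z/=.
      by rewrite FA// FA'// eqxx.
    by rewrite FB// FB'// eqxx.
- rewrite /J ge0_integralZl//.
  by rewrite integral_indic// setIT [X in _ * X]Z0 mule0.
- apply/funext => x; rewrite /J/=; have [->//|neq] := eqVneq (F x) (F' x).
  rewrite indicE mem_set// mule1 !addey//.
    by rewrite gt_eqF// (lt_le_trans _ (F0' x)).
  by rewrite gt_eqF// (lt_le_trans _ (F0 x)).
Qed.

(** With [J] added, [F] and [F'] become equal, while [conv J G] vanishes almost everywhere by the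
    norm identity. Here [0 * +oo = 0] covers a [G] of infinite integral. *)
Lemma conv_ae_eql (F F' G : H * K -> \bar R) :
  nonneg_supp A B F -> nonneg_supp A B F' -> nonneg_supp A B G ->
  {ae mu, forall x, F x = F' x} -> {ae mu, forall x, econv F G x = econv F' G x}.
Proof.
move=> sF sF' sG /(ae_eq_absorber sF sF')[J [sJ J0 FJ]].
apply: (@ae_imply _ _ _ mu (fun x => econv J G x = 0)) => [|x JG].
  by apply: conv_ae_eq0; rewrite // J0 mul0e.
have E : econv (F \+ J) G x = econv (F' \+ J) G x by rewrite FJ.
by move: E; rewrite (convDl x sF sJ sG) (convDl x sF' sJ sG) JG !adde0.
Qed.

Lemma conv_ae_eqr (F G G' : H * K -> \bar R) :
  nonneg_supp A B F -> nonneg_supp A B G -> nonneg_supp A B G' ->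
  {ae mu, forall x, G x = G' x} -> {ae mu, forall x, econv F G x = econv F G' x}.
Proof.
move=> sF sG sG' /(ae_eq_absorber sG sG')[J [sJ J0 GJ]].
apply: (@ae_imply _ _ _ mu (fun x => econv F J x = 0)) => [|x FJ].
  by apply: conv_ae_eq0; rewrite // J0 mule0.
have E : econv F (G \+ J) x = econv F (G' \+ J) x by rewrite GJ.
by move: E; rewrite (convDr x sF sG sJ) (convDr x sF sG' sJ) FJ !adde0.
Qed.
End ConvolutionAe.

Lemma cintegral_real d (T : measurableType d) (R : realType)
    (m : {measure set T -> \bar R}) (r : T -> R) :
  cintegral m (fun x => (r x)%:C%C) = (\int[m]_x r x)%:C%C.
Proof.
by rewrite /cintegral/=; congr (_ +i* _)%C; rewrite /Rintegral/= integral0.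
Qed.

(** * Comparison of the complex and extended convolutions *)

Section NonnegConvolution.
Local Open Scope complex_scope.
Context (R : realType) (H K : topGroupType) (tau : autHom H K).
Variables (muH : {measure set (borel H) -> \bar R}) (muK : {measure set (borel K) -> \bar R}).
Hypotheses (hH : hausdorff_space H) (hK : hausdorff_space K).
Hypotheses (haarH : left_haar muH) (haarK : left_haar muK).
Variable delta : H -> R.
Hypothesis mdelta : measurable_fun setT (delta : borel H -> R).
Hypothesis delta_gt0 : forall h, 0 < delta h.
Variables (A : set H) (B : set K).
Hypotheses (sA : sigma_subgroup A) (sB : sigma_subgroup B).

Local Notation tconv := (tau_conv (tau := tau) muH muK delta).
Local Notation econv := (conv muH muK delta).

Lemma tau_conv_realE (f g : H * K -> R[i]) x : nonneg_valued f -> nonneg_valued g ->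
  tconv f g x = (\int[muH]_t (\int[muK]_s (normc (f (t, s)) *
    normc (g (x.1, (s^-1 * x.2)%g))) * delta t))%:C.
Proof.
move=> nf ng; rewrite -[RHS](cintegral_real muH); congr (cintegral _ _); apply/funext => t.
rewrite rmorphM; congr (_ * _).
rewrite -[RHS](cintegral_real muK); congr (cintegral _ _); apply/funext => s.
by rewrite /section_at {1}nf {1}ng -rmorphM.
Qed.

Lemma nonneg_valued_tau_conv (f g : H * K -> R[i]) : nonneg_valued f -> nonneg_valued g ->
  nonneg_valued (tconv f g).
Proof.
move=> nf ng x; rewrite tau_conv_realE// normc_real//.
apply: Rintegral_ge0 => t _; rewrite mulr_ge0// ?(ltW (delta_gt0 _))//.
by apply: Rintegral_ge0 => s _; rewrite mulr_ge0// normc_ge0.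
Qed.

(* [fine] sends an infinite inner integral to [0], but this happens for almost
   no [t] when the convolution is finite at [x]. *)
Lemma enorm_tau_conv f g x : csupported A B f -> csupported A B g ->
  nonneg_valued f -> nonneg_valued g -> (econv (enorm f) (enorm g) x < +oo)%E ->
  enorm (tconv f g) x = econv (enorm f) (enorm g) x.
Proof.
move=> sf sg nf ng coo.
rewrite /enorm tau_conv_realE// normc_real; last first.
  apply: Rintegral_ge0 => t _; rewrite mulr_ge0// ?(ltW (delta_gt0 _))//.
  by apply: Rintegral_ge0 => s _; rewrite mulr_ge0// normc_ge0.
pose J (t : borel H) : \bar R :=
  (\int[muK]_s (enorm f (t, s) * enorm g (x.1, (s^-1 * x.2)%g)) * (delta t)%:E)%E.
have [mJ J0] : ge0_mfun J := ge0_mfun_conv_inner hK haarK mdelta delta_gt0 sB x sf sg.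
have JE t : (\int[muK]_s (normc (f (t, s)) * normc (g (x.1, (s^-1 * x.2)%g))) * delta t)%R =
    fine (J t).
  rewrite /J /Rintegral; under [in RHS]eq_integral do rewrite -EFinM.
  have : (0 <= \int[muK]_s (normc (f (t, s)) * normc (g (x.1, (s^-1 * x.2)%g)))%:E)%E.
    by apply: integral_ge0 => s _; rewrite lee_fin mulr_ge0// normc_ge0.
  case: (\int[muK]_s _)%E => [r _|_|//] /=; first by [].
  by rewrite mul0r gt0_mulye// lte_fin.
under eq_Rintegral do rewrite JE.
have iJ : muH.-integrable setT J.
  by apply/integrableP; split=> //; under eq_integral do rewrite gee0_abs//; exact: coo.
have EJ : (\int[muH]_t (fine (J t))%:E = \int[muH]_t J t)%E.
  apply: ae_eq_integral => //.
    by apply/measurable_EFinP; apply: measurableT_comp mJ; exact: fine_measurable.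
  have := integrable_ae measurableT iJ.
  by move/ae_imply; apply => t Jt _; rewrite fineK//; exact: Jt.
rewrite /Rintegral EJ fineK// ge0_fin_numE//.
by apply: integral_ge0 => t _; exact: J0.
Qed.
End NonnegConvolution.

Lemma continuous_borel_real (R : realType) (T : ptopologicalType) (f : T -> R) :
  continuous f -> measurable_fun setT (f : borel T -> R).
Proof.
move=> cf; apply: (@measurability _ _ (borel T) R setT f _ (RGenOpens.measurableE R)).
move=> _ [_ [a [b ->]] <-]; rewrite setTI; apply: measurable_borel_open.
by apply: open_comp => // x _; exact: cf.
Qed.

Lemma L1fun_ZDE d (T : measurableType d) (R : realType) (m : {measure set T -> \bar R})
    (a : R[i]) (f g : L1fun m) x : (a *: f + g) x = a * f x + g x.
Proof. by []. Qed.

(** * The product on classes *)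

Section TauAlgebra.
Local Open Scope complex_scope.
Local Open Scope quotient_scope.
Context (R : realType) (H K : topGroupType) (lcH : lc_hausdorff H) (lcK : lc_hausdorff K)
    (tau : autHom H K)
    (muH : {measure set (borel H) -> \bar R}) (haarH : left_haar muH)
    (muK : {measure set (borel K) -> \bar R}) (haarK : left_haar muK)
    (delta : H -> R) (hdelta : tau_modulus tau muK delta)
    (mu : {measure set (borel (semidirect tau)) -> \bar R})
    (hmu : is_semidirect_haar muH muK delta mu).

Let hH : hausdorff_space H. Proof. by case: lcH. Qed.
Let hK : hausdorff_space K. Proof. by case: lcK. Qed.
Let haar : left_haar mu. Proof. by case: hmu. Qed.
Let mdelta : measurable_fun setT (delta : borel H -> R).
Proof. by apply: continuous_borel_real; case: hdelta. Qed.
Let delta_gt0 h : 0 < delta h. Proof. by case: hdelta. Qed.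

Local Notation tconv := (tau_conv (tau := tau) muH muK delta).
Local Notation econv := (conv muH muK delta).

(** Stated for a sequence so that all functions in one identity share [A] and [B]. The compact sets
    supporting each function are merged by [pickle], projected to [H] and to [K], and enclosed in
    sigma-compact open subgroups. *)
Lemma L1fun_csupported (f : nat -> L1fun mu) : exists A B,
  [/\ sigma_subgroup A, sigma_subgroup B & forall n, csupported A B (f n)].
Proof.
have hG := semidirect_hausdorff (tau := tau) hH hK.
have /choice[C HC] : forall n, exists C : nat -> set (semidirect tau),
    (forall k, compact (C k)) /\
    forall D, closed D -> (forall k, C k `<=` D) -> forall x, ~ D x -> f n x = 0.
  by move=> n; have [C cC CD] := L1fun_support hG haar (f n); exists C.
pose CC k := if unpickle k is Some (n, l) then C n l else set0.
have cCC k : compact (CC k).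
  by rewrite /CC; case: (unpickle k) => [[n l]|]; [have [] := HC n|exact: compact0].
have cfst k : compact (fst @` CC k : set H).
  apply: continuous_compact => //; apply: continuous_subspaceT => z; exact: cvg_fst.
have csnd k : compact (snd @` CC k : set K).
  apply: continuous_compact => //; apply: continuous_subspaceT => z; exact: cvg_snd.
have [A sA CA] := sigma_subgroup_compacts lcH cfst.
have [B sB CB] := sigma_subgroup_compacts lcK csnd.
exists A, B; split=> // n.
have [_ cAB _] := sigma_clopen_prod tau (sigma_subgroup_clopen sA) (sigma_subgroup_clopen sB).
have AB k : C n k `<=` A `*` B.
  move=> z Cz; have CCz : CC (pickle (n, k)) z by rewrite /CC pickleK.
  by split; [apply: (CA _ z.1 (ex_intro2 _ _ z CCz erefl))|
             apply: (CB _ z.2 (ex_intro2 _ _ z CCz erefl))].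
have [_ HCn] := HC n; split.
- exact: cintegrable_cmeasurable (L1fun_integrable (f n)).
- by move=> h k Ah; apply: (HCn _ cAB AB) => -[].
- by move=> h k Bk; apply: (HCn _ cAB AB) => -[].
Qed.

Lemma integral_tau_conv_le A B f g : sigma_subgroup A -> sigma_subgroup B ->
  csupported A B f -> csupported A B g ->
  (\int[mu]_x (normc (tconv f g x))%:E <=
    \int[mu]_x (normc (f x))%:E * \int[mu]_x (normc (g x))%:E)%E.
Proof.
move=> sA sB sf sg; have [nf ng] := (enorm_nonneg sf, enorm_nonneg sg).
rewrite -[leRHS](integral_conv hH hK haarH haarK mdelta delta_gt0 hmu sA sB nf ng).
have [[mc c0] _] := conv_nonneg hH hK haarH haarK mdelta delta_gt0 sA sB nf ng.
apply: ge0_le_integral => //.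
- by move=> x _; rewrite lee_fin normc_ge0.
- apply/measurable_EFinP.
  apply: (@cmeasurable_normc _ (borel (H * K)%type)).
  exact: (measurable_tau_conv _ hH hK haarH haarK mdelta sA sB sf sg).
- move=> x _; exact: (normc_tau_conv_le _ hK haarK mdelta delta_gt0 sB x sf sg).
Qed.

Lemma L1fun_norm_fin (f : L1fun mu) : (\int[mu]_x (normc (f x))%:E < +oo)%E.
Proof.
apply/(cintegrableP _ (cintegrable_cmeasurable (L1fun_integrable f))).
exact: L1fun_integrable.
Qed.

Lemma tau_conv_L1 (f g : L1fun mu) : tconv f g \in @L1pred _ _ R mu.
Proof.
have [A [B [sA sB sfg]]] := L1fun_csupported (fun n => if n is 0 then f else g).
have [sf sg] := (sfg 0%N, sfg 1%N).
apply/asboolP/cintegrableP.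
  exact: (measurable_tau_conv _ hH hK haarH haarK mdelta sA sB sf sg).
apply: le_lt_trans (integral_tau_conv_le sA sB sf sg) _.
apply: lte_mul_pinfty; last exact: L1fun_norm_fin.
  by apply: integral_ge0 => x _; rewrite lee_fin normc_ge0.
rewrite ge0_fin_numE; first exact: L1fun_norm_fin.
by apply: integral_ge0 => x _; rewrite lee_fin normc_ge0.
Qed.

Definition tauc (f g : L1fun mu) : L1fun mu := MkL1fun (tau_conv_L1 f g).

Lemma conv_norm_fin_ae A B (f g : L1fun mu) : sigma_subgroup A -> sigma_subgroup B ->
  csupported A B f -> csupported A B g ->
  {ae mu, forall x, (econv (enorm f) (enorm g) x < +oo)%E}.
Proof.
move=> sA sB sf sg; have [nf ng] := (enorm_nonneg sf, enorm_nonneg sg).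
have [[mc c0] _] := conv_nonneg hH hK haarH haarK mdelta delta_gt0 sA sB nf ng.
have ic : mu.-integrable setT (econv (enorm f) (enorm g)).
  apply/integrableP; split=> //; under eq_integral do rewrite gee0_abs//.
  rewrite (integral_conv hH hK haarH haarK mdelta delta_gt0 hmu sA sB nf ng).
  apply: lte_mul_pinfty; last exact: L1fun_norm_fin.
    by apply: integral_ge0 => x _; rewrite lee_fin normc_ge0.
  rewrite ge0_fin_numE; first exact: L1fun_norm_fin.
  by apply: integral_ge0 => x _; rewrite lee_fin normc_ge0.
have := integrable_ae measurableT ic; apply: filterS => x /(_ I) cfin.
by rewrite -ge0_fin_numE.
Qed.

Lemma tau_conv_converges_ae (f g : L1fun mu) :
  {ae mu, forall x, tau_conv_converges muH muK delta f g x}.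
Proof.
have [A [B [sA sB sfg]]] := L1fun_csupported (fun n => if n is 0 then f else g).
have [sf sg] := (sfg 0%N, sfg 1%N).
apply: (ae_imply (conv_norm_fin_ae sA sB sf sg)) => x.
exact: (tau_conv_convergesP _ hK haarK mdelta delta_gt0 sB sf sg).
Qed.

Lemma normr_tauc_le (f g : L1fun mu) :
  `|\pi_(L1 mu) (tauc f g)| <= `|\pi_(L1 mu) f| * `|\pi_(L1 mu) g|.
Proof.
have [A [B [sA sB sfg]]] := L1fun_csupported (fun n => if n is 0 then f else g).
have [sf sg] := (sfg 0%N, sfg 1%N).
rewrite -[leLHS]/(L1norm _) -[`|\pi_(L1 mu) f|]/(L1norm _) -[`|\pi_(L1 mu) g|]/(L1norm _).
rewrite !L1normE -rmorphM lecR -lee_fin EFinM.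
have fin (h : L1fun mu) : (\int[mu]_x normc (h x))%:E = (\int[mu]_x (normc (h x))%:E)%E.
  rewrite /Rintegral fineK// ge0_fin_numE; first exact: L1fun_norm_fin.
  by apply: integral_ge0 => x _; rewrite lee_fin normc_ge0.
rewrite !fin; exact: integral_tau_conv_le sA sB sf sg.
Qed.

Lemma pi_tauc_linear (a : R[i]) (f1 g1 f2 g2 f3 g3 : L1fun mu) :
  (forall x t s, f3 (t, s) * g3 (x.1, (s^-1 * x.2)%g) =
    a * (f1 (t, s) * g1 (x.1, (s^-1 * x.2)%g)) + f2 (t, s) * g2 (x.1, (s^-1 * x.2)%g)) ->
  \pi_(L1 mu) (tauc f3 g3) = a *: \pi_(L1 mu) (tauc f1 g1) + \pi_(L1 mu) (tauc f2 g2).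
Proof.
move=> E.
have [A [B [sA sB s]]] := L1fun_csupported (nth 0 [:: f1; g1; f2; g2; f3; g3]).
rewrite -L1_piZD; apply/L1piP.
apply: (ae_imply2 (tau_conv_converges_ae f1 g1) (tau_conv_converges_ae f2 g2)) => x c1 c2.
exact: (tau_conv_linear hK haarK mdelta sB (s 0%N) (s 1%N)
  (s 2%N) (s 3%N) (s 4%N) (s 5%N) c1 c2 (E x)).
Qed.

Definition tau_op (u v : L1 mu) : L1 mu := \pi_(L1 mu) (tauc (repr u) (repr v)).

Lemma normr_tau_op_le u v : `|tau_op u v| <= `|u| * `|v|.
Proof.
by apply: le_trans (normr_tauc_le _ _) _; rewrite !reprK.
Qed.

(** By linearity a change of representative adds a convolution with a function of zero norm, and the
    norm bound makes the class of that convolution zero. *)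
Lemma pi_tauc_wd (f f' g g' : L1fun mu) :
  \pi_(L1 mu) f = \pi_(L1 mu) f' -> \pi_(L1 mu) g = \pi_(L1 mu) g' ->
  \pi_(L1 mu) (tauc f g) = \pi_(L1 mu) (tauc f' g').
Proof.
move=> ff' gg'; transitivity (\pi_(L1 mu) (tauc f' g)).
  have : \pi_(L1 mu) (tauc (- 1 *: f' + f) g) = 0.
    apply/normr0_eq0/le_anti; rewrite normr_ge0 andbT.
    apply: le_trans (normr_tauc_le _ _) _.
    by rewrite L1_piZD ff' scaleN1r addNr normr0 mul0r.
  rewrite (@pi_tauc_linear (- 1) f' g f g).
    by rewrite scaleN1r addrC => /eqP; rewrite subr_eq0 => /eqP.
  by move=> x t s; rewrite L1fun_ZDE mulrDl mulrA.
have : \pi_(L1 mu) (tauc f' (- 1 *: g' + g)) = 0.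
  apply/normr0_eq0/le_anti; rewrite normr_ge0 andbT.
  apply: le_trans (normr_tauc_le _ _) _.
  by rewrite L1_piZD gg' scaleN1r addNr normr0 mulr0.
rewrite (@pi_tauc_linear (- 1) f' g' f' g).
  by rewrite scaleN1r addrC => /eqP; rewrite subr_eq0 => /eqP.
by move=> x t s; rewrite L1fun_ZDE mulrDr mulrCA.
Qed.

Lemma tau_opE (f g : L1fun mu) :
  tau_op (\pi_(L1 mu) f) (\pi_(L1 mu) g) = \pi_(L1 mu) (tauc f g).
Proof. by apply: pi_tauc_wd; rewrite reprK. Qed.

Lemma tau_op_convolution : is_tau_convolution muH muK delta tau_op.
Proof.
move=> f g; rewrite /L1class tau_opE.
have /L1piP : \pi_(L1 mu) (repr (\pi_(L1 mu) (tauc f g))) = \pi_(L1 mu) (tauc f g) by rewrite reprK.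
by move=> rE; apply: (ae_imply2 (tau_conv_converges_ae f g) rE).
Qed.

Lemma tau_op_linearr u : linear (tau_op u).
Proof.
move=> a; elim/quotW: u => f; elim/quotW => g; elim/quotW => g'.
rewrite -L1_piZD !tau_opE; apply: pi_tauc_linear => x t s.
by rewrite L1fun_ZDE mulrDr mulrCA.
Qed.

Lemma tau_op_linearl v : linear (tau_op^~ v).
Proof.
move=> a; elim/quotW: v => g; elim/quotW => f; elim/quotW => f'.
rewrite -L1_piZD !tau_opE; apply: pi_tauc_linear => x t s.
by rewrite L1fun_ZDE mulrDl mulrA.
Qed.
Lemma enorm_tauc_ae (A : set H) (B : set K) (f g : L1fun mu) :
  sigma_subgroup A -> sigma_subgroup B ->
  csupported A B f -> csupported A B g -> nonneg_valued f -> nonneg_valued g ->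
  {ae mu, forall x, enorm (tauc f g) x = econv (enorm f) (enorm g) x}.
Proof.
move=> sA sB sf sg nf ng; have [ef eg] := (enorm_nonneg sf, enorm_nonneg sg).
have := conv_norm_fin_ae sA sB sf sg.
move/ae_imply; apply => x xoo.
exact: (enorm_tau_conv _ hK haarK mdelta delta_gt0 sB sf sg nf ng xoo).
Qed.

Lemma nonneg_valued_tauc (f g : L1fun mu) :
  nonneg_valued f -> nonneg_valued g -> nonneg_valued (tauc f g).
Proof. exact: nonneg_valued_tau_conv. Qed.

(** A chain of almost-everywhere equalities: the outer complex convolution becomes [conv], the inner
    one is replaced inside [conv] by [conv_ae_eql] or [conv_ae_eqr], and the middle link is the
    everywhere valid [convA]. Nonnegative functions are recovered from their moduli. *)
Lemma tauc_nonnegA (f g e : L1fun mu) :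
  nonneg_valued f -> nonneg_valued g -> nonneg_valued e ->
  \pi_(L1 mu) (tauc (tauc f g) e) = \pi_(L1 mu) (tauc f (tauc g e)).
Proof.
move=> nf ng ne.
have [A [B [sA sB s]]] := L1fun_csupported (nth 0 [:: f; g; e]).
have [sf sg se] : [/\ csupported A B f, csupported A B g & csupported A B e].
  by split; [exact: (s 0%N)|exact: (s 1%N)|exact: (s 2%N)].
have sfg : csupported A B (tauc f g).
  exact: (csupported_tau_conv _ hH hK haarH haarK mdelta delta_gt0 sA sB sf sg).
have sge : csupported A B (tauc g e).
  exact: (csupported_tau_conv _ hH hK haarH haarK mdelta delta_gt0 sA sB sg se).
have [nfg nge] := (nonneg_valued_tauc nf ng, nonneg_valued_tauc ng ne).
have [[ef eg] [ee [efg ege]]] := ((enorm_nonneg sf, enorm_nonneg sg),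
  (enorm_nonneg se, (enorm_nonneg sfg, enorm_nonneg sge))).
have cn F G := @conv_nonneg _ _ _ _ _ hH hK haarH haarK delta mdelta delta_gt0 A B sA sB F G.
have ae1 := enorm_tauc_ae sA sB sfg se nfg ne.
have ae2 := conv_ae_eql hH hK haarH haarK mdelta delta_gt0 hmu sA sB efg (cn _ _ ef eg) ee
  (enorm_tauc_ae sA sB sf sg nf ng).
have ae3 := conv_ae_eqr hH hK haarH haarK mdelta delta_gt0 hmu sA sB ef ege (cn _ _ eg ee)
  (enorm_tauc_ae sA sB sg se ng ne).
have ae4 := enorm_tauc_ae sA sB sf sge nf nge.
apply/L1piP; apply: (ae_imply2 (ae_imply2 ae1 ae2 (fun x => @conj _ _))
  (ae_imply2 ae3 ae4 (fun x => @conj _ _))) => x [E1 E2] [E3 E4].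
have E : enorm (tauc (tauc f g) e) x = enorm (tauc f (tauc g e)) x.
  have EA := congr1 (fun F => F x) (convA hH hK haarH haarK mdelta delta_gt0 sA sB ef eg ee).
  exact: etrans E1 (etrans E2 (etrans EA (etrans (esym E3) (esym E4)))).
rewrite (nonneg_valued_tauc nfg ne x) (nonneg_valued_tauc nf nge x).
exact: (congr1 (fun r => r%:C) (EFin_inj E)).
Qed.

(** Both sides are linear in each of the three arguments, so [L1_nonneg_ind], applied once per
    argument, leaves nonnegative functions. *)
Lemma tau_opA : associative tau_op.
Proof.
move=> u v w; apply/esym; move: u v w.
have lin_r u := tau_op_linearr u.
have lin_l u := tau_op_linearl u.
apply: L1_nonneg_ind => [a u u' IH IH' v w|f nf].
  by rewrite !lin_l IH IH'.
apply: L1_nonneg_ind => [a v v' IH IH' w|g ng].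
  by rewrite lin_r !lin_l lin_r IH IH'.
apply: L1_nonneg_ind => [a w w' IH IH'|e ne].
  by rewrite !lin_r IH IH'.
by rewrite !tau_opE; exact: tauc_nonnegA.
Qed.
End TauAlgebra.

Theorem theorem3p2 (R : realType) (H K : topGroupType)
    (lcH : lc_hausdorff H) (lcK : lc_hausdorff K)
    (tau : autHom H K)
    (muH : {measure set (borel H) -> \bar R}) (haarH : left_haar muH)
    (muK : {measure set (borel K) -> \bar R}) (haarK : left_haar muK)
    (delta : H -> R) (hdelta : tau_modulus tau muK delta)
    (mu : {measure set (borel (semidirect tau)) -> \bar R})
    (hmu : is_semidirect_haar muH muK delta mu) :
  exists op : L1 mu -> L1 mu -> L1 mu,
    is_tau_convolution muH muK delta op /\ banach_algebra op.
Proof.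
exists (tau_op lcH lcK haarH haarK hdelta hmu); split.
  exact: tau_op_convolution.
split.
- exact: L1_complete.
- by split; [exact: tau_op_linearr|exact: tau_op_linearl].
- exact: tau_opA.
- exact: normr_tau_op_le.
Qed.
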